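(* There exists a full Lebesgue measure set $\mathbf{R}\subset[0,1]$ of irrational numbers with the following property: given a minimal orientation-preserving circle homeomorphism $f$ with $\rho(f)\in\mathbf{R}$ and given any point $x\in S^1$, there exists a set $\mathcal{B}_x\subset S^1$ which is residual (in the Baire sense) and has full $\mu_f$-measure ($\mu_f$ being the unique $f$-invariant Borel probability measure) such that for all $y\in\mathcal{B}_x$ the renormalization trail $\{(\rho_n,\alpha_n)\}_{n\ge0}$ of $y$ (with respect to $x$ and $f$) is dense in the rectangle $[0,1]\times[-1,1]$.
   Context: Let $f:S^1\to S^1$ be a minimal orientation-preserving homeomorphism with irrational rotation number $\rho=[a_0,a_1,\dots]$ (continued fraction expansion) and unique invariant probability measure $\mu$. Let $q_0=1$, $q_1=a_0$, $q_{n+1}=a_nq_n+q_{n-1}$. Fix $x\in S^1$. For $n\ge0$, $I_n$ is the interval with endpoints $x$ and $f^{q_n}(x)$ containing $f^{q_{n+2}}(x)$; all intervals are taken open on the left and closed on the right. For each $n$ the intervals $f^i(I_n)$, $0\le i\le q_{n+1}-1$ (long), and $f^j(I_{n+1})$, $0\le j\le q_n-1$ (short), partition $S^1$. Renormalization trail of $y\in S^1$ with respect to $x$ and $f$: the sequence $\{(\rho_n,\alpha_n)\}_{n\ge0}\subset([0,1]\setminus\mathbb{Q})\times[-1,1]$ defined as follows. $\rho_n=G^n(\rho)=[a_n,a_{n+1},\dots]$, where $G(\rho)=\{1/\rho\}$ is the Gauss map. $\alpha_0$ is the $\mu$-measure of the arc going counterclockwise from $y$ to $x$ (that is, $\alpha_0=\mu$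 of the arc of $I_1$ between $y$ and $x$ if $y\in I_1$, and $\alpha_0=1-\mu((x,y))$ otherwise). For $n\ge0$: if $y\in f^i(I_n)$ with $0\le i\le q_{n+1}-1$, let $y_n\in I_n$ be such that $f^i(y_n)=y$ and set $\alpha_{n+1}=\mu((x,y_n))/\mu(I_n)\in[0,1]$, where $(x,y_n)$ is the subarc of $I_n$ between $x$ and $y_n$; otherwise $y\in f^j(I_{n+1})$ with $0\le j\le q_n-1$, let $y_n\in I_{n+1}$ be such that $f^j(y_n)=y$ and set $\alpha_{n+1}=-\mu((y_n,x))/\mu(I_{n+1})\in[-1,0]$, where $(y_n,x)$ is the subarc of $I_{n+1}$ between $y_n$ and $x$. *)

(* Defs.v *)
From HB Require Import structures.
From mathcomp Require Import all_boot all_order all_algebra.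
From mathcomp Require Import all_classical all_reals all_analysis.
From mathcomp Require Import borel_hierarchy.

Set Implicit Arguments.
Unset Strict Implicit.
Unset Printing Implicit Defensive.
Import Order.TTheory GRing.Theory Num.Theory.
Import numFieldNormedType.Exports.
Local Open Scope classical_set_scope.
Local Open Scope ring_scope.

(** [circle R] is R/Z with the quotient topology and its Borel sigma-algebra. *)
Section circle.
Variable R : realType.

Definition circle_rel (s t : R) : bool := (s - t) \is a Num.int.

Lemma circle_rel_equiv : equiv_class_of circle_rel.
Proof.
split=> [s|s t|t s u st tu]; rewrite /circle_rel.
- by rewrite subrr rpred0.
- by rewrite -opprB rpredN.
- by rewrite -(subrKA t) rpredD.
Qed.
Canonical circle_equivRel := EquivRelPack circle_rel_equiv.

Definition circle := quotient_topology {eq_quot circle_rel}%qT.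
HB.instance Definition _ := Quotient.on circle.
HB.instance Definition _ := PointedTopological.on circle.
HB.instance Definition _ := @isMeasurable.Build (sigma_display (@open circle))
  circle <<s @open circle >> (@sigma_algebra0 _ setT _) (@sigma_algebraC _ _)
  (@sigma_algebra_bigcup _ setT _).

Definition to_circle (t : R) : circle := \pi_circle%qT t.

(** Length, in [0, 1), of the counterclockwise path from [a] to [z]; it does
    not depend on the representatives chosen by [repr]. *)
Definition ccw (a z : circle) : R :=
  let t := (repr z - repr a)%qT in t - (Num.floor t)%:~R.

(** Counterclockwise arc from [a] to [b], open on the left and closed on the
    right; [arc a a] is empty. *)
Definition arc (a b : circle) : set circle :=
  [set z | 0 < ccw a z <= ccw a b].

End circle.

Section dynamics.
Variable R : realType.
Implicit Types (f : circle R -> circle R) (F : R -> R) (x y z : circle R).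

Definition homeomorphism f : Prop :=
  exists g, [/\ cancel f g, cancel g f, continuous f & continuous g].

Definition increasing_lift F f : Prop :=
  [/\ continuous F, {homo F : s t / s < t},
      forall t, F (t + 1) = F t + 1
    & forall t, to_circle (F t) = f (to_circle t)].

Definition orientation_preserving_homeo f : Prop :=
  homeomorphism f /\ exists F, increasing_lift F f.

Definition full_orbit f x : set (circle R) :=
  [set y | exists n, y = iter n f x \/ x = iter n f y].

Definition minimal f : Prop := forall x, dense (full_orbit f x).

(** Lifts differ by integer constants, so the normalisation to [0, 1)
    determines [rho]. *)
Definition is_rotation_number f (rho : R) : Prop :=
  0 <= rho < 1 /\
  exists2 F, increasing_lift F f
    & forall t, (fun n : nat => iter n F t / n%:R) @ \oo --> rho.

Definition invariant_measure f (mu : probability (circle R) R) : Prop :=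
  forall A, measurable A -> mu (f @^-1` A) = mu A.

Definition residual (B : set (circle R)) : Prop :=
  exists2 G, Gdelta_dense G & G `<=` B.

End dynamics.

Section continued_fraction.
Variable R : realType.

Definition gauss (r : R) : R := r^-1 - (Num.floor r^-1)%:~R.

Definition cf_tail (rho : R) (n : nat) : R := iter n gauss rho.

(** rho = [a_0, a_1, ...] = 1 / (a_0 + 1 / (a_1 + ...)). *)
Definition partial_quotient (rho : R) (n : nat) : nat :=
  Num.truncn (cf_tail rho n)^-1.

Fixpoint cf_den (rho : R) (n : nat) : nat :=
  match n with
  | 0 => 1
  | m.+1 => match m with
            | 0 => partial_quotient rho 0
            | k.+1 => partial_quotient rho m * cf_den rho m + cf_den rho k
            end
  end%N.

End continued_fraction.

Section renormalization.
Variables (R : realType) (f : circle R -> circle R).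
Variables (mu : probability (circle R) R) (rho : R) (x : circle R).

Let q := cf_den rho.
Let xq n : circle R := iter (q n) f x.

(** Of the two arcs with endpoints [x] and [f^(q_n) x], does the
    counterclockwise one starting at [x] contain [f^(q_(n+2)) x]? *)
Definition on_right (n : nat) : bool := xq n.+2 \in arc x (xq n).

(** The interval I_n. *)
Definition dyn_interval (n : nat) : set (circle R) :=
  if on_right n then arc x (xq n) else arc (xq n) x.

(** For [z] in I_n, the subarc of I_n between [x] and [z]. *)
Definition subarc (n : nat) (z : circle R) : set (circle R) :=
  if on_right n then arc x z else arc z x.

(** Points [z] of I_n with [f^i z = y] for some [i < m]. *)
Definition tower_base (n m : nat) (y : circle R) : set (circle R) :=
  [set z | dyn_interval n z /\ exists2 i, (i < m)%N & iter i f z = y].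

Definition relative_position (n : nat) (z : circle R) : R :=
  fine (mu (subarc n z)) / fine (mu (dyn_interval n)).

(** The dynamical partition makes [tower_base n (q n.+1) y] and
    [tower_base n.+1 (q n) y] a singleton and an empty set, in some order;
    [xget] selects the point y_n in the nonempty one. *)
Definition trail_alpha (y : circle R) (n : nat) : R :=
  match n with
  | 0 => fine (mu (arc y x))
  | m.+1 =>
      if `[< tower_base m (q m.+1) y !=set0 >]
      then relative_position m (xget x (tower_base m (q m.+1) y))
      else - relative_position m.+1 (xget x (tower_base m.+1 (q m) y))
  end.

Definition renormalization_trail (y : circle R) (n : nat) : R * R :=
  (cf_tail rho n, trail_alpha y n).

End renormalization.

(* Main.v *)
(** The distribution function of [mu] conjugates [f] to the rotation by [rho], so
    the trail of [y] only depends on [rho] and on the position [t = mu((x, y))].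
    If [t = i rho + d_n s] mod 1 with [0 < s < 1] and [i < q_(n+1)], where
    [d_n = q_n rho - p_n], then [alpha_(n+1) = s]; if [t = j rho + d_(n+1) s]
    with [j < q_n], then [alpha_(n+1) = - s].

    Both full-measure statements are porosity arguments: by Lebesgue's density
    theorem a set is null as soon as each of its points has arbitrarily small
    neighbourhoods containing an interval of comparable length that avoids the
    set. For the Gauss map, bounded distortion of the Moebius inverse branches
    shows that almost every [rho] visits every rational interval infinitely
    often. Given such a [rho] and a target rectangle, there are infinitely many
    [n] with [rho_n > 1/2] and [rho_(n+1)] in the target; for these the points
    [j rho], [j < q_n], are within [4 |d_n|] of every point, and next to each of
    them lies an interval of length comparable to [|d_n|] on which
    [alpha_(n+1)] is in the target. The set of good points thus has an interior of
    full measure, and a conull open set is dense since [mu] charges every arc. *)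

Require Import Defs.
From HB Require Import structures.
From mathcomp Require Import all_boot all_order all_algebra.
From mathcomp Require Import all_classical all_reals all_analysis.
From mathcomp Require Import borel_hierarchy measurable_realfun ring lra zify.
Set Implicit Arguments.
Unset Strict Implicit.
Unset Printing Implicit Defensive.
Import Order.TTheory GRing.Theory Num.Theory.
Import numFieldNormedType.Exports.
Local Open Scope classical_set_scope.
Local Open Scope ring_scope.

(** * Continued fractions *)

Section continued_fraction_theory.
Variable R : realType.

Lemma irrational_gauss (r : R) : irrational r -> irrational (gauss r).
Proof.
move=> ir [q _ qE]; apply: ir; exists (q + (Num.floor r^-1)%:~R)^-1 => //.
by rewrite fmorphV rmorphD /= ratr_int qE /gauss subrK invrK.
Qed.

Lemma irrational_int (r : R) : irrational r -> r \isn't a Num.int.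
Proof. by move=> ir; apply/negP => /intrP[m mE]; apply: ir; exists m%:~R => //; rewrite ratr_int. Qed.

Lemma gauss_itv (r : R) : irrational r -> 0 < gauss r < 1.
Proof.
move=> /irrational_gauss/irrational_int ig.
have := floor_itv r^-1; rewrite intrD => /andP[h1 h2].
apply/andP; split; last by rewrite /gauss; lra.
rewrite lt_neqAle subr_ge0 h1 andbT.
by apply: contra ig => /eqP <-; rewrite rpred0.
Qed.

Variable rho : R.
Hypotheses (irho : irrational rho) (rho01 : 0 < rho < 1).

Local Notation tail := (cf_tail rho).
Local Notation a := (partial_quotient rho).
Local Notation q := (cf_den rho).

Lemma irrational_cf_tail n : irrational (tail n).
Proof. by elim: n => //= n; exact: irrational_gauss. Qed.

Lemma cf_tail_itv n : 0 < tail n < 1.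
Proof. by case: n => //= n; apply: gauss_itv; exact: irrational_cf_tail. Qed.

Lemma partial_quotient_gt0 n : (0 < a n)%N.
Proof.
have /andP[t0 t1] := cf_tail_itv n.
rewrite /partial_quotient truncn_gt0 invr_ge1 ?ltW //.
by rewrite unitfE gt_eqF.
Qed.

Lemma cf_tailV n : (tail n)^-1 = (a n)%:R + tail n.+1.
Proof.
have /andP[t0 t1] := cf_tail_itv n.
have t0' : 0 <= (tail n)^-1 by rewrite invr_ge0 ltW.
rewrite /partial_quotient [tail n.+1]/= /gauss -/(tail n) truncn_floor t0'.
rewrite natr_absz ger0_norm ?floor_ge0 //; ring.
Qed.

(** This product of Gauss iterates is the distance |q_n rho - p_n|; with the sign (-1)^n, as in
    [cf_sgap], it is q_n rho - p_n itself. *)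
Definition cf_gap n : R := \prod_(i < n.+1) tail i.
Local Notation e := cf_gap.

Lemma cf_gapS n : e n.+1 = tail n.+1 * e n.
Proof. by rewrite /cf_gap big_ord_recr /= mulrC. Qed.

Lemma cf_gap_gt0 n : 0 < e n.
Proof. by apply: prodr_gt0 => i _; have /andP[] := cf_tail_itv i. Qed.

Lemma cf_gapSS n : e n.+2 = e n - (a n.+1)%:R * e n.+1.
Proof.
have /andP[t0 t1] := cf_tail_itv n.+1.
rewrite cf_gapS; have -> : tail n.+2 = (tail n.+1)^-1 - (a n.+1)%:R.
  by rewrite cf_tailV addrC addKr.
by rewrite mulrBl cf_gapS mulKf // gt_eqF.
Qed.

Lemma cf_gap0 : e 0 = rho.
Proof. by rewrite /cf_gap big_ord_recr big_ord0 /= mul1r. Qed.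

Lemma cf_gap1 : e 1 = 1 - (a 0)%:R * rho.
Proof.
rewrite cf_gapS cf_gap0; have := cf_tailV 0; rewrite [tail 0]/= => h.
have -> : tail 1 = rho^-1 - (a 0)%:R by rewrite h addrC addKr.
by rewrite mulrBl mulVf // gt_eqF //; case/andP: rho01.
Qed.

Lemma cf_gap_ltS n : e n.+1 < e n.
Proof.
have /andP[t0 t1] := cf_tail_itv n.+1.
by rewrite cf_gapS gtr_pMl // cf_gap_gt0.
Qed.

Lemma cf_gap_lt1 n : e n < 1.
Proof.
elim: n => [|n]; last exact: (lt_trans (cf_gap_ltS n)).
by rewrite cf_gap0; case/andP: rho01.
Qed.

Lemma cf_denSS n : q n.+2 = (a n.+1 * q n.+1 + q n)%N. Proof. by []. Qed.

Lemma cf_den_gt0 n : (0 < q n)%N.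
Proof.
elim/ltn_ind: n => -[|[|n]] // IH; first exact: partial_quotient_gt0.
by rewrite cf_denSS addn_gt0 (IH n) ?orbT.
Qed.

Lemma cf_den_leS n : (q n <= q n.+1)%N.
Proof.
case: n => [|n]; first by rewrite partial_quotient_gt0.
rewrite cf_denSS (leq_trans (leq_pmull _ (partial_quotient_gt0 n.+1))) //.
exact: leq_addr.
Qed.

Lemma cf_den_geS n : (n < q n.+1)%N.
Proof.
elim: n => [|n IH]; first exact: partial_quotient_gt0.
have := cf_den_gt0 n; have := partial_quotient_gt0 n.+1; rewrite cf_denSS; nia.
Qed.

(** Total length of the dynamical partition: q_(n+1) long intervals of length e_n and q_n short ones
    of length e_(n+1) fill the circle. *)
Lemma cf_den_gap n : (q n.+1)%:R * e n + (q n)%:R * e n.+1 = 1.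
Proof.
elim: n => [|n IH]; first by rewrite cf_gap0 cf_gap1 /=; ring.
by rewrite -[RHS]IH cf_denSS cf_gapSS natrD natrM; ring.
Qed.

Lemma cf_gap_le n : e n <= n.+1%:R^-1.
Proof.
have h := cf_den_gap n; have h1 := cf_gap_gt0 n; have h2 := cf_gap_gt0 n.+1.
have : (n.+1)%:R <= (q n.+1)%:R :> R by rewrite ler_nat cf_den_geS.
move=> nq; have n0 : 0 < n.+1%:R :> R by rewrite ltr0n.
rewrite -(ler_pM2l n0) mulfV ?gt_eqF //.
have : 0 <= (q n)%:R * e n.+1 by rewrite mulr_ge0 // ltW.
nra.
Qed.

Lemma cf_gap_cvg0 (eps : R) : 0 < eps -> exists N, forall n, (N <= n)%N -> e n < eps.
Proof.
move=> eps0; exists (Num.truncn eps^-1) => n Nn.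
apply: (le_lt_trans (cf_gap_le n)); rewrite invf_plt ?posrE ?ltr0n //.
apply: (lt_le_trans (truncnS_gt _)); by rewrite ler_nat ltnS.
Qed.

Definition cf_sgap n : R := (-1) ^+ n * e n.
Local Notation d := cf_sgap.

Lemma cf_sgapSS n : d n.+2 = d n + (a n.+1)%:R * d n.+1.
Proof. by rewrite /cf_sgap cf_gapSS !exprS; ring. Qed.

Lemma cf_sgap_int n : d n - (q n)%:R * rho \is a Num.int.
Proof.
elim/ltn_ind: n => -[|[|n]] IH.
- by rewrite /cf_sgap cf_gap0 /= !mul1r subrr rpred0.
- rewrite /cf_sgap cf_gap1 /= expr1.
  have -> : -1 * (1 - (a 0)%:R * rho) - (a 0)%:R * rho = - 1 by ring.
  by rewrite rpredN1.
- have -> : d n.+2 - (q n.+2)%:R * rho =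
     (d n - (q n)%:R * rho) + (a n.+1)%:R * (d n.+1 - (q n.+1)%:R * rho).
    by rewrite cf_sgapSS cf_denSS natrD natrM; ring.
  by rewrite rpredD ?rpredM ?natr_int ?IH.
Qed.

(** The vectors (q_n, p_n) and (q_(n+1), p_(n+1)) form a basis of Z^2; by the recurrence,
    coordinates (u, v) at level n become (v - u a_(n+1), u) at the next level. *)
Lemma cf_lattice n (k p : int) : exists u v : int,
  k = u * (q n)%:Z + v * (q n.+1)%:Z /\
  k%:~R * rho - p%:~R = u%:~R * d n + v%:~R * d n.+1.
Proof.
elim: n => [|n [u [v [kE xE]]]].
  exists (k - (a 0)%:Z * p), p; split; first by rewrite /=; ring.
  rewrite /cf_sgap cf_gap0 cf_gap1 /= expr0 expr1 intrB intrM -pmulrn; ring.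
exists (v - u * (a n.+1)%:Z), u; split; first by rewrite kE cf_denSS PoszD PoszM; ring.
rewrite xE cf_sgapSS intrB intrM -pmulrn; ring.
Qed.

(** In the coordinates of [cf_lattice] the distance is |u e_n - v e_(n+1)|. If v = 0, it is below
    e_n only for u = 0. If v is nonzero, |k| < q_(n+1) forces u to be nonzero of the opposite sign,
    so both terms add up to more than e_n. *)
Lemma cf_best_approx n (k p : int) :
  `|k| < (q n.+1)%:Z -> `|k%:~R * rho - p%:~R| < e n -> k = 0.
Proof.
have [u [v [-> ->]]] := cf_lattice n k p.
have e0 := cf_gap_gt0 n; have e1 := cf_gap_gt0 n.+1.
have q0 := cf_den_gt0 n; have q1 := cf_den_gt0 n.+1.
have -> : u%:~R * d n + v%:~R * d n.+1 = (-1) ^+ n * (u%:~R * e n - v%:~R * e n.+1).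
  by rewrite /cf_sgap exprS; ring.
rewrite normrM normrX normrN1 expr1n mul1r => kq.
have [v0|v0|v0] := ltgtP v 0; last first.
- rewrite v0 mul0r subr0 normrM (gtr0_norm e0) gtr_pMl // => hu.
  have : `|u| < 1 by rewrite -(ltr_int R) intr_norm.
  by move=> ?; have -> : u = 0 by lia.
- rewrite ltr_norml => /andP[h1 h2].
  have [u0|u0] := lerP u 0; last by exfalso; nia.
  have [u0'|u0'] := lerP 0 u; first by exfalso; nia.
  have u1 : u%:~R <= -1 :> R by rewrite -[-1]/((-1)%:~R) ler_int; lia.
  have v1 : 1 <= v%:~R :> R by rewrite -[1]/(1%:~R) ler_int; lia.
  exfalso; nra.
- rewrite ltr_norml => /andP[h1 h2].
  have [u0|u0] := lerP 0 u; last by exfalso; nia.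
  have [u0'|u0'] := lerP u 0; first by exfalso; nia.
  have u1 : 1 <= u%:~R :> R by rewrite -[1]/(1%:~R) ler_int; lia.
  have v1 : v%:~R <= -1 :> R by rewrite -[-1]/((-1)%:~R) ler_int; lia.
  exfalso; nra.
Qed.

(* Writing [k = u q_n + v q_(n+1)], the middle term is [u e_n - v e_(n+1)]; it lies
   in the interval only if [u >= 1, v >= 0] or [u <= 0, v <= -1]. *)
Lemma cf_tower_gap n (k p : int) : - (q n.+1)%:Z < k -> k < (q n)%:Z ->
  ~~ (0 < (-1) ^+ n * (k%:~R * rho - p%:~R) < e n + e n.+1).
Proof.
have [u [v [-> ->]]] := cf_lattice n k p.
have e0 := cf_gap_gt0 n; have e1 := cf_gap_gt0 n.+1.
have q0 := cf_den_gt0 n; have q1 := cf_den_gt0 n.+1.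
have -> : (-1) ^+ n * (u%:~R * d n + v%:~R * d n.+1) = u%:~R * e n - v%:~R * e n.+1.
  rewrite /cf_sgap exprS; transitivity (((-1) ^+ n * (-1) ^+ n) * (u%:~R * e n - v%:~R * e n.+1)).
    by ring.
  by rewrite -exprMn mulrNN mul1r expr1n mul1r.
move=> k1 k2; apply/negP => /andP[h1 h2].
have [u0|u0] := lerP u 0; have [v0|v0] := lerP 0 v.
- have : u%:~R <= 0 :> R by rewrite lerz0.
  have : 0 <= v%:~R :> R by rewrite ler0z.
  nra.
- nia.
- nia.
- have : 1 <= u%:~R :> R by rewrite -[1]/(1%:~R) ler_int; lia.
  have : v%:~R <= -1 :> R by rewrite -[-1]/((-1)%:~R) ler_int; lia.
  nra.
Qed.

(* Take the lattice point [b (q_n, d_n) - floor (b q_n / q_(n+1)) (q_(n+1), d_(n+1))]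
   where [b] is, up to sign, the integer part of [q_(n+1) beta]. *)
Lemma cf_covering n (beta : R) : exists2 j : nat, (j < q n.+1)%N &
  exists k : int, `|beta - j%:R * rho - k%:~R| <= (q n.+1)%:R^-1 + e n.+1.
Proof.
have Q0 : 0 < (q n.+1)%:R :> R by rewrite ltr0n cf_den_gt0.
set Q := q n.+1; pose m := Num.floor (Q%:R * beta).
pose b : int := (-1) ^+ n * m.
pose c : int := ((b * (q n)%:Z) %/ Q%:Z)%Z.
pose j : int := ((b * (q n)%:Z) %% Q%:Z)%Z.
have Qn0 : Q%:Z != 0 by have := cf_den_gt0 n.+1; rewrite -/Q; lia.
have bE : b * (q n)%:Z = c * Q%:Z + j by exact: divz_eq.
have j0 : 0 <= j by exact: modz_ge0.
have jQ : j < Q%:Z by rewrite ltz_pmod //; have := cf_den_gt0 n.+1; rewrite -/Q; lia.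
have [p0 p0E] := intrP (cf_sgap_int n).
have [p1 p1E] := intrP (cf_sgap_int n.+1).
exists `|j|%N; first by lia.
have jR : (`|j|%N)%:R = b%:~R * (q n)%:R - c%:~R * Q%:R :> R.
  rewrite natr_absz (ger0_norm j0).
  have := congr1 (fun z : int => z%:~R : R) bE.
  by rewrite intrD !intrM -!pmulrn => ->; rewrite addrC addKr.
exists (b * p0 - c * p1).
have Q0' : Q%:R != 0 :> R by rewrite gt_eqF.
have jr : (`|j|%N)%:R / Q%:R = b%:~R * (q n)%:R / Q%:R - c%:~R :> R.
  by rewrite jR; field.
(* By Q d_n - q_n d_(n+1) = (-1)^n the error splits into the rounding error of Q beta, divided by Q,
   and a term below e_(n+1) because j < Q. *)
have -> : beta - `|j|%:R * rho - (b * p0 - c * p1)%:~R =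
    (beta - m%:~R / Q%:R) - (`|j|%:R / Q%:R) * d n.+1.
  have h := cf_den_gap n.
  have hq : Q%:R * d n - (q n)%:R * d n.+1 = (-1) ^+ n.
    by rewrite -[RHS]mulr1 -[X in _ = _ * X]h /cf_sgap exprS; ring.
  have hb : m%:~R = b%:~R * (-1) ^+ n :> R.
    rewrite /b intrM rmorphXn /= mulrAC -exprMn mulrNN mul1r expr1n mul1r //.
  rewrite jr hb -hq jR intrB !intrM -p0E -p1E -/Q.
  by field.
apply: (le_trans (ler_normB _ _)); apply: lerD.
  have /andP[h1 h2] := floor_itv (Q%:R * beta).
  rewrite -/m intrD in h1 h2.
  rewrite -(ler_pM2l Q0) -{1}(gtr0_norm Q0) -normrM mulrBr divff // mulrCA divff // mulr1.
  by rewrite ger0_norm ?subr_ge0 // lerBlDl ltW.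
rewrite /cf_sgap !normrM normrX normrN1 expr1n mul1r (gtr0_norm (cf_gap_gt0 _)).
rewrite ger_pMl ?cf_gap_gt0 // ger0_norm // ger0_norm ?invr_ge0 ?ltW //.
by rewrite ltr_pdivrMr // mul1r ltr_nat; lia.
Qed.

(** Since q_n <= q_(n+1), [cf_den_gap] gives 1 / q_(n+1) <= e_n + e_(n+1), and a tail above 1/2
    means e_n < 2 e_(n+1). *)
Lemma cf_covering_gap n (beta : R) : 2^-1 < tail n.+1 ->
  exists2 j : nat, (j < q n.+1)%N &
  exists k : int, `|beta - j%:R * rho - k%:~R| <= 4 * e n.+1.
Proof.
move=> tn; have [j jq [k h]] := cf_covering n beta.
exists j => //; exists k; apply: (le_trans h).
have h0 := cf_gap_gt0 n; have h1 := cf_gap_gt0 n.+1.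
have Q0 : 0 < (q n.+1)%:R :> R by rewrite ltr0n cf_den_gt0.
have : (q n.+1)%:R^-1 <= e n + e n.+1.
  rewrite -(ler_pM2l Q0) mulfV ?gt_eqF // -[leLHS](cf_den_gap n) mulrDr lerD2l.
  by rewrite ler_pM2r // ler_nat cf_den_leS.
have : e n <= 2 * e n.+1 by rewrite cf_gapS mulrA; nra.
lra.
Qed.

End continued_fraction_theory.

(** * Porosity *)

Section porosity.
Variable R : realType.
Local Notation lambda := (@lebesgue_measure R).

(* By Lebesgue's density theorem, at almost every point of the complement of
   [O] the complement has density one, which the intervals forbid. *)
Lemma negligible_porous (O A : set R) (c : R) : open O -> 0 < c ->
  (forall x, A x -> forall eps : R, 0 < eps -> exists r a b : R,
     [/\ 0 < r < eps, c * r <= b - a, `]a, b[ `<=` ball x r & `]a, b[ `<=` O]) ->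
  lambda.-negligible (A `\` O).
Proof.
move=> oO c0 AO.
have mO : measurable (~` O) by apply: measurableC; exact: open_measurable.
have := lebesgue_density mO; apply: negligibleS => x [Ax Ox] /= cvx.
have {}cvx : (lambda (~` O `&` ball x r) / lambda (ball x r))%E @[r --> 0^'+] --> (1%:E : \bar R).
  by move: cvx; rewrite indicE mem_set.
(* The threshold [1 - c / 2] is the largest proportion left to the complement of [O]: the ball has
   length 2 r and contains an interval of length at least c r inside [O]. *)
have near_lt : \forall r \near (0 : R)^'+,
    ((1 - c / 2)%:E < lambda (~` O `&` ball x r) / lambda (ball x r))%E.
  apply: (cvx [set z | ((1 - c / 2)%:E < z)%E]).
  apply: open_nbhs_nbhs; split; first exact: open_ereal_gt_ereal.
  by rewrite /= lte_fin; lra.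
have [d d0 dE] : exists2 d : R, 0 < d & forall r, 0 < r < d ->
    ((1 - c / 2)%:E < lambda (~` O `&` ball x r) / lambda (ball x r))%E.
  case: near_lt => d /= d0 dE; exists d => // r /andP[r0 rd]; apply: dE => //=.
  by rewrite sub0r normrN gtr0_norm.
have [r [a [b [/andP[r0 rd] crab abx abO]]]] := AO x Ax d d0.
have /dE : 0 < r < d by rewrite r0.
have mB : measurable (ball x r) by exact: measurable_ball.
have ballE : lambda (ball x r) = (r *+ 2)%:E by rewrite lebesgue_measure_ball // ltW.
have splitE : (lambda (ball x r) = lambda (~` O `&` ball x r) + lambda (O `&` ball x r))%E.
  rewrite -measureU //; last 3 first.
  - exact: measurableI.
  - by apply: measurableI => //; exact: open_measurable.
  - by rewrite setIACA setICl set0I.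
  by rewrite -setIUl setUCl setTI.
have abE : ((c * r)%:E <= lambda (O `&` ball x r))%E.
  apply: (@le_trans _ _ (lambda `]a, b[)).
    rewrite lebesgue_measure_itv /= lte_fin; case: ifPn => ab.
      by rewrite -EFinB lee_fin.
    by rewrite lee_fin; rewrite -leNgt in ab; nra.
  apply: le_measure; rewrite ?inE //.
  - by apply: measurableI => //; exact: open_measurable.
  - by move=> t abt; split; [exact: abO|exact: abx].
have fin1 : lambda (~` O `&` ball x r) \is a fin_num.
  rewrite ge0_fin_numE // (@le_lt_trans _ _ (lambda (ball x r))) ?ballE ?ltry //.
  by rewrite -ballE splitE leeDl.
have fin2 : lambda (O `&` ball x r) \is a fin_num.
  rewrite ge0_fin_numE // (@le_lt_trans _ _ (lambda (ball x r))) ?ballE ?ltry //.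
  by rewrite -ballE splitE leeDr.
move: splitE abE; rewrite ballE -(fineK fin1) -(fineK fin2) -EFinD.
set v := fine _; set w := fine _ => -[vw]; rewrite lee_fin => cw.
rewrite inver mulrn_eq0 /= gt_eqF // -EFinM lte_fin ltr_pdivlMr ?pmulrn_lgt0 //.
rewrite -mulr_natl in vw *; nra.
Qed.

End porosity.

(** * The Gauss map *)

Section gauss_map.
Variable R : realType.

Lemma gauss_branchK (k : int) (t : R) : 0 < t < 1 -> gauss (k%:~R + t)^-1 = t.
Proof.
move=> /andP[t0 t1]; rewrite /gauss invrK.
have -> : Num.floor (k%:~R + t) = k.
  by apply: floor_def; rewrite intrD lerDl ltW //= ltrD2l.
by rewrite addrAC subrr add0r.
Qed.

Lemma irrational_branch (x : R) : irrational x -> 0 < x < 1 ->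
  exists2 k : int, 1 <= k & x = (k%:~R + gauss x)^-1.
Proof.
move=> ix /andP[x0 x1]; exists (Num.floor x^-1).
  by rewrite floor_ge_int invr_ge1 ?ltW // unitfE gt_eqF.
by rewrite /gauss addrC subrK invrK.
Qed.

(* The [n]-th iterate of the Gauss map is invertible on the cylinder of [x],
   with inverse the Moebius map [t |-> (A t + B) / (C t + D)]. *)
Lemma cf_tail_branch n (x : R) : irrational x -> 0 < x < 1 ->
  exists A B C D : R,
  [/\ [/\ 0 <= A <= B, 1 <= B, 0 <= C <= D, n.+1%:R <= D & `|A * D - B * C| = 1],
      x = (A * cf_tail x n.+1 + B) / (C * cf_tail x n.+1 + D)
    & forall t, 0 < t < 1 -> 0 < (A * t + B) / (C * t + D) < 1 /\
        cf_tail ((A * t + B) / (C * t + D)) n.+1 = t].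
Proof.
elim: n x => [|n IH] x ix x01; have [k k1 xE] := irrational_branch ix x01.
  have k1R : 1 <= k%:~R :> R by rewrite ler1z.
  exists 0, 1, 1, k%:~R; split.
  - by split; rewrite ?lexx ?ler01 // mul0r sub0r normrN mulr1 normr1.
  - by rewrite mul0r add0r mul1r mul1r [cf_tail x 1]/= addrC -xE.
  move=> t t01; rewrite mul0r add0r !mul1r addrC; split; last exact: gauss_branchK.
  by case/andP: t01 => t0 t1; rewrite invr_gt0 invf_lt1; lra.
have tE y : cf_tail y n.+2 = cf_tail (gauss y) n.+1 by rewrite /cf_tail iterSr.
have k1R : 1 <= k%:~R :> R by rewrite ler1z.
have [A [B [C [D [[/andP[A0 AB] B1 /andP[C0 CD] nD AD1] gE br]]]]] :=
  IH (gauss x) (irrational_gauss ix) (gauss_itv ix).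
have n0 : 0 <= n.+1%:R :> R by [].
have stepE t : 0 < t < 1 -> (k%:~R + (A * t + B) / (C * t + D))^-1 =
    (C * t + D) / ((k%:~R * C + A) * t + (k%:~R * D + B)).
  move=> /andP[t0 t1].
  have ? : 0 <= C * t by rewrite mulr_ge0 // ltW.
  have ? : 0 <= A * t by rewrite mulr_ge0 // ltW.
  have D1 : 1 <= D by rewrite (le_trans _ nD) // ler1n.
  have ? : 0 <= k%:~R * C by rewrite mulr_ge0 //; lra.
  have ? : 0 <= k%:~R * D by rewrite mulr_ge0 //; lra.
  have h : 0 <= (k%:~R * C + A) * t by apply: mulr_ge0; [exact: addr_ge0|exact: ltW].
  field; rewrite !gt_eqF //; try lra.
(* Coefficients of the old branch followed by t |-> 1 / (k + t). The determinant only changes sign,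
   and k D + B >= D + 1 because k and B are at least 1. *)
exists C, D, (k%:~R * C + A), (k%:~R * D + B); split.
- split.
  + by rewrite C0.
  + by rewrite (le_trans _ nD) // ler1n.
  + by apply/andP; split; nra.
  + by rewrite -[n.+2%:R]natr1; nra.
  + by rewrite -AD1 -normrN; congr `|_|; ring.
- rewrite tE -stepE -?gE //; exact: cf_tail_itv (irrational_gauss ix) (gauss_itv ix) _.
move=> t t01; rewrite -stepE // tE.
have [br1 br2] := br t t01; rewrite gauss_branchK //; split=> //.
case/andP: br1 => h0 h1; rewrite invr_gt0 invf_lt1; lra.
Qed.

End gauss_map.

(** * Almost every Gauss orbit visits every rational window infinitely often *)

Section gauss_visits.
Variable R : realType.
Local Notation lambda := (@lebesgue_measure R).

Lemma itvoo_subset_interior (V : set R) (a b : R) :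
  `]a, b[ `<=` V -> `]a, b[ `<=` (V : set R)^°.
Proof.
have oI := @interval_open R (BRight a) (BLeft b) isT isT.
by move=> sub; have := sub; rewrite (open_subsetE _ oI).
Qed.

(** The inverse branch [phi] through x maps (u, v) into the visiting set. As 0 <= C <= D, it
    contracts distances in [0, 1] by a factor between 1 / (4 D^2) and 1 / D^2; hence radius D^-2 and
    porosity constant (v - u) / 4. *)
Lemma cf_tail_visits (u v : R) N : 0 <= u -> u < v -> v <= 1 ->
  lambda.-negligible
    ([set x | irrational x /\ 0 < x < 1]
      `\` [set x | exists2 n, (N <= n)%N & u < cf_tail x n < v]).
Proof.
move=> u0 uv v1; pose V : set R := [set x | exists2 n, (N <= n)%N & u < cf_tail x n < v].
(* Porosity is stated for open sets, so the visiting set is replaced by its interior. *)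
suff : lambda.-negligible ([set x : R | irrational x /\ 0 < x < 1] `\` (V : set R)^°).
  by apply: negligibleS => x [? nV]; split=> // /interior_subset.
apply: (@negligible_porous _ _ _ ((v - u) / 4)); [exact: open_interior|lra|].
move=> x [ix x01] eps eps0.
(* Since D >= n + 1 > 1 / eps, the radius D^-2 is below eps; the visit at time n + 1 comes after
   N. *)
pose n := maxn N (Num.truncn eps^-1).
have [A [B [C [D [[/andP[A0 AB] B1 /andP[C0 CD] nD AD1] xE br]]]]] := cf_tail_branch n ix x01.
have t01 := cf_tail_itv ix x01 n.+1.
pose phi t := (A * t + B) / (C * t + D).
have D0 : 0 < D by rewrite (lt_le_trans _ nD) // ltr0n.
have CtD t : 0 <= t -> 0 < C * t + D by move=> ?; rewrite ltr_wpDl // mulr_ge0.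
have phiB s t : 0 <= s -> 0 <= t ->
    `|phi s - phi t| = `|s - t| / ((C * s + D) * (C * t + D)).
  move=> s0 t0; have hs := CtD _ s0; have ht := CtD _ t0.
  have -> : phi s - phi t = (A * D - B * C) * ((s - t) / ((C * s + D) * (C * t + D))).
    by rewrite /phi; field; rewrite !gt_eqF.
  rewrite normrM AD1 mul1r normrM; congr (_ * _).
  by rewrite gtr0_norm // invr_gt0 mulr_gt0.
have mnx : Num.max (phi u) (phi v) - Num.min (phi u) (phi v) = `|phi v - phi u|.
  by rewrite /Num.max /Num.min; case: ltP => h; [rewrite gtr0_norm|rewrite ler0_norm]; lra.
have phi_cont : {within `[u, v], continuous phi}.
  apply: continuous_in_subspaceT => t; rewrite inE /= in_itv /= => /andP[ut tv].
  have ht : C * t + D != 0 by rewrite gt_eqF // CtD //; lra.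
  apply: cvgM; first by apply: cvgD; [apply: cvgMr; exact: cvg_id|exact: cvg_cst].
  by apply: cvgV => //; apply: cvgD; [apply: cvgMr; exact: cvg_id|exact: cvg_cst].
(* The determinant may be -1, so [phi] may reverse orientation; [Num.min] and [Num.max] cover both
   cases. *)
have phi_onto y : Num.min (phi u) (phi v) < y < Num.max (phi u) (phi v) ->
    exists2 t, u < t < v & phi t = y.
  move=> /andP[y1 y2].
  have [|t] := @IVT _ phi u v y (ltW uv) phi_cont; first by rewrite !ltW.
  rewrite in_itv /= => /andP[ut tv] yE; exists t => //.
  rewrite !lt_neqAle ut tv !andbT; apply/andP; split; apply/eqP => tE.
    by move: y1 y2; rewrite -yE -tE; case: (lerP (phi u) (phi v)) => h; lra.
  by move: y1 y2; rewrite -yE tE; case: (lerP (phi u) (phi v)) => h; lra.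
exists (D^-1 ^+ 2), (Num.min (phi u) (phi v)), (Num.max (phi u) (phi v)); split.
- rewrite exprn_gt0 ?invr_gt0 //=.
  have D1 : 1 <= D by rewrite (le_trans _ nD) // ler1n.
  apply: (@le_lt_trans _ _ D^-1).
    by rewrite expr2 ger_pMl ?invr_gt0 // invf_le1.
  rewrite invf_plt ?posrE //; apply: (lt_le_trans _ nD).
  apply: (lt_le_trans (truncnS_gt _)); by rewrite ler_nat ltnS leq_maxr.
- have v0 : 0 <= v by lra.
  have hu := CtD _ u0; have hv := CtD _ v0.
  rewrite mnx phiB // gtr0_norm ?subr_gt0 // -mulrA ler_pM2l ?subr_gt0 //.
  rewrite exprVn; have -> : 4^-1 / D ^+ 2 = ((2 * D) ^+ 2)^-1 by field; rewrite gt_eqF.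
  rewrite lef_pV2 ?posrE ?mulr_gt0 ?exprn_gt0 // ?mulr_gt0 //.
  have : C * u <= D by nra.
  have : C * v <= D by nra.
  by rewrite expr2 => ? ?; apply: ler_pM; lra.
- move=> y; rewrite /= in_itv /= => /phi_onto[t /andP[ut tv] <-].
  case/andP: t01 => t0 t1; have s0 : 0 <= t by lra.
  rewrite /ball /= {1}xE -/(phi _) phiB ?s0 ?(ltW t0) //.
  have hs := CtD _ s0; have ht := CtD _ (ltW t0).
  rewrite ltr_pdivrMr ?mulr_gt0 //; apply: (@lt_le_trans _ _ 1).
    by rewrite ltr_norml; lra.
  rewrite exprVn ler_pdivlMl ?exprn_gt0 // mulr1 expr2.
  have ? : 0 <= C * t by rewrite mulr_ge0.
  have ? : 0 <= C * cf_tail x n.+1 by rewrite mulr_ge0 // ltW.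
  by apply: ler_pM; lra.
- suff sub : `]Num.min (phi u) (phi v), Num.max (phi u) (phi v)[ `<=` V.
    exact: itvoo_subset_interior.
  move=> y; rewrite /= in_itv /= => /phi_onto[t /andP[ut tv] <-]; exists n.+1.
    by rewrite (leq_trans (leq_maxl _ _) (leqnSn _)).
  by have [|_ ->] := br t; [lra|rewrite ut].
Qed.

Lemma negligible_bigcup_count (T : countType) (F : T -> set R) :
  (forall i, lambda.-negligible (F i)) -> lambda.-negligible (\bigcup_i F i).
Proof.
move=> nF.
suff : lambda.-negligible (\bigcup_(k : nat) oapp F set0 (unpickle k)).
  by apply: negligibleS => x [i _ Fx]; exists (pickle i) => //; rewrite pickleK.
apply: negligible_bigcup => k; case: unpickle => [i|] //=; exact: negligible_set0.
Qed.

(** The full-measure set of rotation numbers. Rational endpoints keep the conditions countable, and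
    the bound [N] turns each visit into infinitely many. *)
Definition gauss_generic : set R := [set rho | [/\ 0 <= rho <= 1, irrational rho &
  forall (u v : rat) (N : nat), 0 <= u -> u < v -> v <= 1 ->
    exists2 n, (N <= n)%N & ratr u < cf_tail rho n < ratr v]].

Lemma negligible_gauss_nongeneric : lambda.-negligible (`[0, 1] `\` gauss_generic).
Proof.
pose bad (i : rat * rat * nat) : set R :=
  if (0 <= i.1.1) && (i.1.1 < i.1.2) && (i.1.2 <= 1) then
  [set x | irrational x /\ 0 < x < 1]
    `\` [set x | exists2 n, (i.2 <= n)%N & ratr i.1.1 < cf_tail x n < ratr i.1.2]
  else set0.
have nbad : lambda.-negligible (\bigcup_i bad i).
  apply: negligible_bigcup_count => i; rewrite /bad.
  case: ifPn => [/andP[/andP[u0 uv] v1]|_]; last exact: negligible_set0.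
  by apply: cf_tail_visits; rewrite ?ler0q ?ltr_rat // -(rmorph1 ratr) ler_rat.
have nrat : lambda.-negligible (@rational R).
  have -> : @rational R = \bigcup_(p : rat) [set ratr p].
    by apply/seteqP; split=> x [p _ xE]; exists p.
  apply: negligible_bigcup_count => p.
  by exists [set ratr p]; split=> //; exact: lebesgue_measure_set1.
apply: negligibleS (negligibleU nrat nbad) => x [/= x01 ngx].
apply/or_asboolP; rewrite -[_ || _]negbK negb_or; apply/negP => /andP[/asboolPn ix /asboolPn nx].
apply: ngx; split=> //.
move=> u v N u0 uv v1; apply: contrapT => nE; apply: nx; exists (u, v, N) => //.
rewrite /bad /= u0 uv v1 /=; split=> //; split=> //.
move: x01; rewrite in_itv /= => /andP[x0 x1].
rewrite !lt_neqAle x0 x1 !andbT; apply/andP; split; apply/eqP => xE; apply: ix.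
  by exists 0 => //; rewrite -xE rmorph0.
by exists 1 => //; rewrite xE rmorph1.
Qed.

End gauss_visits.

(** * The circle *)

Section circle_theory.
Variable R : realType.
Local Notation S := (@to_circle R).

Definition fpart (t : R) : R := t - (Num.floor t)%:~R.

Lemma fpart_itv t : 0 <= fpart t < 1.
Proof.
have := floor_itv t; rewrite intrD => /andP[h1 h2].
by apply/andP; split; rewrite /fpart; lra.
Qed.

Lemma fpartE t m : 0 <= t - m%:~R < 1 -> fpart t = t - m%:~R.
Proof.
move=> /andP[h1 h2]; rewrite /fpart; have -> // : Num.floor t = m.
by apply: floor_def; rewrite intrD; apply/andP; split; lra.
Qed.

Lemma fpart_id t : 0 <= t < 1 -> fpart t = t.
Proof. by move=> t01; rewrite (@fpartE _ 0) subr0. Qed.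

Lemma fpartD_int t k : k \is a Num.int -> fpart (t + k) = fpart t.
Proof.
move=> /intrP[m ->]; have /andP[h0 h1] := fpart_itv t.
rewrite (@fpartE _ (Num.floor t + m)) intrD; first by rewrite /fpart; lra.
by rewrite /fpart in h0 h1; apply/andP; split; lra.
Qed.

Lemma fpart_eq s t : s - t \is a Num.int -> fpart s = fpart t.
Proof. by move=> st; rewrite -(fpartD_int t st) addrC subrK. Qed.

Lemma to_circle_eqP s t : S s = S t <-> s - t \is a Num.int.
Proof. by split=> [/(@eqmodP _ (circle_equivRel R))|h]; last exact/eqmodP. Qed.

Lemma to_circleK z : S (repr z) = z.
Proof. exact: reprK. Qed.

Lemma to_circleDint t (k : int) : S (t + k%:~R) = S t.
Proof. by apply/to_circle_eqP; rewrite addrC addKr intr_int. Qed.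

Lemma to_circle_fpart a t : S (a + fpart (t - a)) = S t.
Proof.
apply/to_circle_eqP.
have -> : a + fpart (t - a) - t = - (Num.floor (t - a))%:~R by rewrite /fpart; ring.
by rewrite rpredN intr_int.
Qed.

Lemma ccw_to_circle s t : ccw (S s) (S t) = fpart (t - s).
Proof.
apply: fpart_eq.
have -> : repr (S t) - repr (S s) - (t - s) = (repr (S t) - t) - (repr (S s) - s) by ring.
by rewrite rpredB //; apply/to_circle_eqP; rewrite to_circleK.
Qed.

Lemma arc_to_circle (a b : R) : a <= b < a + 1 -> Defs.arc (S a) (S b) = S @` `]a, b].
Proof.
move=> /andP[ab ba]; apply/seteqP; split=> z; rewrite /Defs.arc /=.
  rewrite -[z in ccw _ z]to_circleK !ccw_to_circle.
  rewrite [X in _ <= X]fpart_id; last by apply/andP; split; lra.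
  move=> /andP[h1 h2]; exists (a + fpart (repr z - a)).
    by rewrite /= in_itv /=; apply/andP; split; lra.
  by rewrite to_circle_fpart to_circleK.
move=> [s]; rewrite /= in_itv /= => /andP[h1 h2] <-.
rewrite !ccw_to_circle !fpart_id //; apply/andP; split; lra.
Qed.

Lemma ccw_itv (a z : circle R) : 0 <= ccw a z < 1.
Proof. exact: fpart_itv. Qed.

Lemma to_circle_ccw t z : S (t + ccw (S t) z) = z.
Proof. by rewrite -[z in ccw _ z]to_circleK ccw_to_circle to_circle_fpart to_circleK. Qed.

Lemma arc_ccw t z : Defs.arc (S t) z = S @` `]t, t + ccw (S t) z].
Proof.
have /andP[h1 h2] := ccw_itv (S t) z.
by rewrite -{1}(to_circle_ccw t z) arc_to_circle //; apply/andP; split; lra.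
Qed.

Lemma openPcircle (U : set (circle R)) : open U <-> open (S @^-1` U).
Proof. by []. Qed.

Lemma open_measurable_circle (U : set (circle R)) : open U -> measurable U.
Proof. by move=> oU; apply: sub_sigma_algebra. Qed.

Lemma continuous_measurable_circle (f : circle R -> circle R) : continuous f ->
  measurable_fun setT f.
Proof.
move=> /continuousP cf; apply: (@measurability _ _ _ _ _ _ (@open (circle R))) => //.
by move=> _ [U oU <-]; rewrite setTI; apply: open_measurable_circle; exact: cf.
Qed.

(** The saturation of [U] is the union of its integer translates, so the projection is an open
    map. *)
Lemma open_image_to_circle (U : set R) : open U -> open (S @` U).
Proof.
move=> oU; apply/openPcircle.
have -> : S @^-1` (S @` U) = \bigcup_(k : int) ((fun t : R => t + k%:~R) @^-1` U).
  apply/seteqP; split=> [t [s Us /to_circle_eqP/intrP[k kE]]|t [k _ /= Ut]].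
    by exists k => //=; rewrite -kE addrC subrK.
  by exists (t + k%:~R) => //; exact: to_circleDint.
apply: bigcup_open => k _.
have /continuousP : continuous (fun t : R => t + k%:~R) by
  move=> t; apply: cvgD; [exact: cvg_id|exact: cvg_cst].
exact.
Qed.

Lemma to_circle_turn a b : a + 1 <= b -> S @` `]a, b] = setT.
Proof.
move=> ab; apply/seteqP; split=> // z _.
have /andP[h0 h1] := fpart_itv (a + 1 - repr z).
exists (a + 1 - fpart (a + 1 - repr z)).
  by rewrite /= in_itv /=; apply/andP; split; lra.
rewrite -[RHS]to_circleK; apply/to_circle_eqP.
have -> : a + 1 - fpart (a + 1 - repr z) - repr z = (Num.floor (a + 1 - repr z))%:~R.
  by rewrite /fpart; ring.
exact: intr_int.
Qed.

Lemma to_circle_inj s t a : S s = S t -> a < s < a + 1 -> a < t <= a + 1 -> s = t.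
Proof.
move=> /to_circle_eqP/intrP[k kE] /andP[h1 h2] /andP[h3 h4].
have : k%:~R < 1 :> R by lra.
have : -1 < k%:~R :> R by lra.
rewrite -[-1]/((-1)%:~R) -[1]/(1%:~R) !ltr_int => k1 k2.
have k0 : k = 0 by lia.
by move: kE; rewrite k0; lra.
Qed.

(** Open arcs are Borel, and a nonempty half-open arc shorter than a turn is the difference of two
    open arcs ending at a + 1. *)
Lemma measurable_arc a b : measurable (S @` `]a, b]).
Proof.
have [ba|ab] := leP b a.
  by rewrite set_itv_ge ?image_set0 // -leNgt bnd_simp.
have [ab1|ba1] := leP (a + 1) b; first by rewrite to_circle_turn.
have moo c d : measurable (S @` `]c, d[).
  by apply: open_measurable_circle; apply: open_image_to_circle; exact: interval_open.
suff -> : S @` `]a, b] = S @` `]a, a + 1[ `\` S @` `]b, a + 1[ by exact: measurableD.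
apply/seteqP; split=> [z [t]|z [[t]]]; rewrite /= in_itv /= => /andP[t1 t2] <-.
  split; first by exists t; rewrite //= in_itv /= t1 /=; lra.
  move=> [s]; rewrite /= in_itv /= => /andP[s1 s2] st.
  by have := to_circle_inj st (a := a); rewrite s2 t1 /=; lra.
move=> nt; exists t => //=; rewrite in_itv /= t1 /= leNgt; apply/negP => bt.
by apply: nt; exists t => //=; rewrite in_itv /= bt.
Qed.

End circle_theory.

(** * Arc masses and the distribution function of the measure *)

Section circle_measure.
Variables (R : realType) (mu : probability (circle R) R).
Local Notation S := (@to_circle R).

Definition arc_mass (a b : R) : R := fine (mu (S @` `]a, b])).
Local Notation nu := arc_mass.

Lemma arc_massE a b : mu (S @` `]a, b]) = (nu a b)%:E.
Proof. by rewrite fineK // fin_num_measure //; exact: measurable_arc. Qed.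

Lemma arc_mass_ge0 a b : 0 <= nu a b.
Proof. exact: fine_ge0. Qed.

Lemma arc_mass_le1 a b : nu a b <= 1.
Proof. by rewrite -lee_fin -arc_massE probability_le1 //; exact: measurable_arc. Qed.

Lemma arc_mass_turn a : nu a (a + 1) = 1.
Proof. by rewrite /nu to_circle_turn // probability_setT. Qed.

Lemma arc_massDint (k : int) a b : nu (a + k%:~R) (b + k%:~R) = nu a b.
Proof.
rewrite /nu; congr (fine (mu _)); apply/seteqP; split=> z [t]; rewrite /= in_itv /= => /andP[h1 h2] <-.
  exists (t - k%:~R); first by rewrite /= in_itv /=; apply/andP; split; lra.
  by rewrite -(to_circleDint _ k) subrK.
exists (t + k%:~R); first by rewrite /= in_itv /=; apply/andP; split; lra.
exact: to_circleDint.
Qed.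

Lemma arc_massD a b c : a <= b -> b <= c -> c <= a + 1 -> nu a c = nu a b + nu b c.
Proof.
move=> ab bc ca; apply: EFin_inj; rewrite EFinD -!arc_massE -measureU.
- congr (mu _); apply/seteqP; split=> [z [t]|z [|] [t]]; rewrite /= in_itv /= => /andP[h1 h2] <-.
  + by case: (leP t b) => tb; [left|right]; exists t => //=; rewrite in_itv /= ?h1 ?tb.
  + by exists t => //=; rewrite in_itv /= h1 /=; lra.
  + by exists t => //=; rewrite in_itv /= h2 andbT; lra.
- exact: measurable_arc.
- exact: measurable_arc.
- apply/seteqP; split=> // z [[s]]; rewrite /= in_itv /= => /andP[s1 s2] <- [t].
  rewrite in_itv /= => /andP[t1 t2] ts.
  have [sE|sa] := eqVneq s (a + 1); first by lra.
  have := to_circle_inj (esym ts) (a := a).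
  rewrite s1 /= lt_neqAle sa /=; lra.
Qed.

(* The distribution function of [mu] on the line, up to an additive constant;
   the winding number is carried by the integer part. *)
Definition cumul (t : R) : R := (Num.floor t)%:~R + nu (Num.floor t)%:~R t.
Local Notation M := cumul.

Lemma cumulDint t (k : int) : M (t + k%:~R) = M t + k%:~R.
Proof.
by rewrite /M floorDrz ?intr_int // intrKfloor intrD arc_massDint; ring.
Qed.

Lemma cumulB a b : a <= b -> b <= a + 1 -> M b - M a = nu a b.
Proof.
move=> ab ba; have := floor_itv a; have := floor_itv b.
rewrite /M; set m := Num.floor a; set n := Num.floor b.
rewrite !intrD => /andP[n1 n2] /andP[m1 m2].
(* A path of at most one turn crosses at most one integer; when it crosses m + 1, the unit mass of
   the turn starting at m is split at a. *)
have [nm|nm] : n = m \/ n = m + 1.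
  have : m%:~R < (n + 1)%:~R :> R by rewrite intrD; lra.
  have : n%:~R < (m + 2)%:~R :> R by rewrite intrD; lra.
  by rewrite !ltr_int; lia.
- rewrite nm in n1 n2 *.
  have := @arc_massD m%:~R a b m1 ab; lra.
- rewrite nm intrD in n1 n2 *.
  have h1 := arc_mass_turn m%:~R.
  have h2 := @arc_massD m%:~R a (m%:~R + 1) m1.
  have h3 := @arc_massD a (m%:~R + 1) b.
  rewrite h2 in h1; rewrite ?lexx ?h3; lra.
Qed.

Lemma cumul_le : {homo M : a b / a <= b}.
Proof.
move=> a b ab; have /andP[h0 h1] := fpart_itv (b - a).
have bE : b = (a + fpart (b - a)) + (Num.floor (b - a))%:~R by rewrite /fpart; ring.
have hf : 0 <= (Num.floor (b - a))%:~R :> R by rewrite ler0z floor_ge0 subr_ge0.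
have := @cumulB a (a + fpart (b - a)); have := arc_mass_ge0 a (a + fpart (b - a)).
have -> : M b = M (a + fpart (b - a)) + (Num.floor (b - a))%:~R by rewrite {1}bE cumulDint.
lra.
Qed.

(** Bounded distance to the identity lets the growth of [M] along an orbit be compared with the
    rotation number. *)
Lemma cumul_near t : `|M t - t| <= 1.
Proof.
have := floor_itv t; rewrite intrD => /andP[h1 h2].
have := arc_mass_ge0 (Num.floor t)%:~R t; have := arc_mass_le1 (Num.floor t)%:~R t.
by rewrite ler_norml /M; lra.
Qed.

End circle_measure.

(** * Minimal circle homeomorphisms *)

Section circle_dynamics.
Variables (R : realType) (f g : circle R -> circle R) (F : R -> R) (rho : R).
Variable mu : probability (circle R) R.
Hypotheses (fK : cancel f g) (gK : cancel g f).
Hypotheses (cf : continuous f) (cg : continuous g).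
Hypotheses (minf : minimal f) (liftF : increasing_lift F f).
Hypothesis rotF : forall t, (fun n : nat => iter n F t / n%:R) @ \oo --> rho.
Hypothesis invf : invariant_measure f mu.
Hypotheses (irho : irrational rho) (rho01 : 0 < rho < 1).

Local Notation S := (@to_circle R).
Local Notation M := (cumul mu).
Local Notation nu := (arc_mass mu).

Lemma lift_lt : {mono F : s t / s < t}.
Proof. by case: liftF => _ Fh _ _; apply: leW_mono; apply: le_mono. Qed.

Lemma lift_le : {mono F : s t / s <= t}.
Proof. by case: liftF => _ Fh _ _; apply: le_mono. Qed.

Lemma liftDint t (k : int) : F (t + k%:~R) = F t + k%:~R.
Proof.
have [_ _ F1 _] := liftF.
have Fn s (n : nat) : F (s + n%:R) = F s + n%:R.
  elim: n s => [|n IH] s; first by rewrite !addr0.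
  by rewrite -natr1 !addrA F1 IH.
case: k => n; first exact: Fn.
by rewrite NegzE mulrNz -[in RHS](subrK n.+1%:R t) Fn addrK.
Qed.

Lemma to_circle_lift t : S (F t) = f (S t).
Proof. by case: liftF. Qed.

Lemma preimage_arc a b : f @^-1` (S @` `]F a, F b]) = S @` `]a, b].
Proof.
apply/seteqP; split=> [z [s]|_ [t + <-]]; rewrite /= in_itv /= => /andP[s1 s2].
  rewrite -(to_circleK z) -to_circle_lift => /to_circle_eqP/intrP[k kE].
  have sE : s = F (repr z + k%:~R) by rewrite liftDint -kE; ring.
  exists (repr z + k%:~R); last exact: to_circleDint.
  by rewrite /= in_itv /= -lift_lt -lift_le -sE s1.
exists (F t); last exact: to_circle_lift.
by rewrite /= in_itv /= lift_lt lift_le s1.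
Qed.

Lemma arc_mass_lift a b : nu (F a) (F b) = nu a b.
Proof. by rewrite /arc_mass -invf ?preimage_arc //; exact: measurable_arc. Qed.

(** Invariance means that [F] preserves arc masses, that is, increments of [M]; hence M(F t) - M t
    does not depend on t. *)
Lemma cumul_lift_const t : M (F t) = M t + (M (F 0) - M 0).
Proof.
have [_ _ F1 _] := liftF; have /andP[h0 h1] := fpart_itv t.
have -> : t = fpart t + (Num.floor t)%:~R by rewrite /fpart subrK.
rewrite liftDint !cumulDint.
have : M (F (fpart t)) - M (F 0) = nu 0 (fpart t).
  by rewrite cumulB ?arc_mass_lift ?lift_le // -F1 lift_le add0r ltW.
have : M (fpart t) - M 0 = nu 0 (fpart t) by rewrite cumulB // add0r ltW.
lra.
Qed.

(** With [theta] the constant displacement, M(F^n 0) = M 0 + n theta; as [M] stays near the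
    identity, F^n 0 = n theta + O(1), so theta is the rotation number. *)
Lemma cumul_lift t : M (F t) = M t + rho.
Proof.
rewrite cumul_lift_const; congr (_ + _); set theta := M (F 0) - M 0.
have Mn n : M (iter n F 0) = M 0 + n%:R * theta.
  elim: n => [|n IH]; first by rewrite mul0r addr0.
  by rewrite iterS cumul_lift_const -/theta IH -natr1; ring.
apply/eqP; rewrite -subr_eq0; apply/negPn/negP => d0.
have {}d0 : 0 < `|theta - rho| by rewrite normr_gt0.
have /cvgrPdist_lt /(_ (`|theta - rho| / 2)) := rotF 0.
rewrite divr_gt0 // => /(_ isT)[N _ HN].
(* If theta differs from rho, then n |theta - rho| < 2 + n |theta - rho| / 2, which fails once n
   |theta - rho| > 4. *)
pose n := maxn N (Num.truncn (4 / `|theta - rho|)).+1.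
have /HN : (N <= n)%N by exact: leq_maxl.
have n0 : 0 < n%:R :> R by rewrite ltr0n leq_max orbT.
have n4 : 4 < n%:R * `|theta - rho|.
  rewrite -ltr_pdivrMr //; apply: (lt_le_trans (truncnS_gt _)).
  by rewrite ler_nat leq_maxr.
rewrite /= -(ltr_pM2l n0) -{1}(gtr0_norm n0) -normrM mulrBr mulrCA divff ?gt_eqF // mulr1.
have := cumul_near mu (iter n F 0); have := cumul_near mu 0; rewrite Mn subr0.
rewrite mulrA; set X := n%:R * `|theta - rho| in n4 *.
have : `|n%:R * theta - n%:R * rho| = X by rewrite -mulrBr normrM gtr0_norm.
set T := n%:R * theta; set Y := n%:R * rho; set Z := iter n F 0.
move=> TY h1 h2 h3.
have := ler_normD (T - Z) (Z - Y); rewrite addrA subrK TY.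
have : `|T - Z| <= 2.
  have -> : T - Z = (M 0 + T - Z) - M 0 by ring.
  by have := ler_normB (M 0 + T - Z) (M 0); lra.
rewrite [ `|Z - Y|]distrC; lra.
Qed.

Lemma cumul_iter_lift n t : M (iter n F t) = M t + n%:R * rho.
Proof.
elim: n => [|n IH]; first by rewrite mul0r addr0.
by rewrite iterS cumul_lift IH -natr1; ring.
Qed.

(* The orbit of an arc under [f] covers the circle by minimality, so an arc of
   measure zero would force [mu] to vanish. *)
Lemma arc_mass_gt0 a b : a < b -> 0 < nu a b.
Proof.
move=> ab; rewrite lt_neqAle arc_mass_ge0 andbT; apply/negP => /eqP ab0.
pose W := S @` `]a, b[.
have oW : open W by apply: open_image_to_circle; exact: interval_open.
have mW : measurable W by exact: open_measurable_circle.
have W0 : mu W = 0.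
  apply/eqP; rewrite eq_le measure_ge0 andbT.
  have <- : mu (S @` `]a, b]) = 0 by rewrite arc_massE -ab0.
  apply: le_measure; rewrite ?inE //; first exact: measurable_arc.
  by apply: image_subset => t; rewrite /= !in_itv /= => /andP[-> /ltW].
have mpre (h : circle R -> circle R) (A : set (circle R)) : continuous h -> measurable A -> measurable (h @^-1` A).
  by move=> ch mA; rewrite -[X in measurable X]setTI; exact: continuous_measurable_circle.
have itern n : measurable (iter n f @^-1` W) /\ mu (iter n f @^-1` W) = 0.
  elim: n => [|n [mn IH]] //.
  have -> : iter n.+1 f @^-1` W = f @^-1` (iter n f @^-1` W).
    by apply/seteqP; split=> z /=; rewrite -iterSr.
  by split; [exact: mpre|rewrite invf].
have itergn n : measurable (iter n g @^-1` W) /\ mu (iter n g @^-1` W) = 0.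
  elim: n => [|n [mn IH]] //.
  have E : iter n.+1 g @^-1` W = g @^-1` (iter n g @^-1` W).
    by apply/seteqP; split=> z /=; rewrite -iterSr.
  rewrite E; split; first exact: mpre.
  rewrite -invf; last exact: mpre.
  by rewrite -IH; congr (mu _); apply/seteqP; split=> z /=; rewrite fK.
(* Each full orbit meets [W] in forward or backward time, so preimages under the iterates of both
   [f] and [g] are used to cover the circle. *)
have negT : mu.-negligible setT.
  apply: (@negligibleS _ _ _ _ ((\bigcup_n (iter n f @^-1` W)) `|` (\bigcup_n (iter n g @^-1` W)))).
    move=> z _; have [|y [Wy [n [yE|zE]]]] := minf z _ oW.
    - exists (S ((a + b) / 2)), ((a + b) / 2) => //=; rewrite in_itv /=; lra.
    - by left; exists n => //=; rewrite -yE.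
    - right; exists n => //=; rewrite zE.
      suff -> : iter n g (iter n f y) = y by [].
      by elim: n y {zE Wy} => // n IH y; rewrite iterSr [iter n.+1 f y]iterS fK IH.
  apply: negligibleU; apply: negligible_bigcup => n.
    by have [mn n0] := itern n; exact/negligibleP.
  by have [mn n0] := itergn n; exact/negligibleP.
have muT : mu setT = 0 := measure_negligible measurableT negT.
by have := probability_setT mu; rewrite muT => /esym/eqP; rewrite onee_eq0.
Qed.

Lemma cumul_lt : {homo M : a b / a < b}.
Proof.
move=> a b ab.
have [ba|ba] := leP b (a + 1); first by have := cumulB mu (ltW ab) ba; have := arc_mass_gt0 ab; lra.
have := cumul_le mu (ltW ba); rewrite -[1]/(1%:~R) cumulDint; lra.
Qed.

Lemma cumul_mono : {mono M : a b / a <= b}.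
Proof. exact: le_mono cumul_lt. Qed.

Lemma cumul_mono_lt : {mono M : a b / a < b}.
Proof. exact: leW_mono cumul_mono. Qed.

(** The point is F^(q_n) t moved by an integer. As d_n tends to 0 with alternating signs, values of
    [M] accumulate at M t from both sides, which rules out jumps. *)
Lemma cumul_shift n t : exists s, M s = M t + cf_sgap rho n.
Proof.
have /intrP[k kE] := cf_sgap_int irho rho01 n.
exists (iter (cf_den rho n) F t + k%:~R).
by rewrite cumulDint cumul_iter_lift -kE; ring.
Qed.

(** An even and an odd shift give s > t and r < t whose values lie within eps of M t; monotonicity
    controls [M] between r and s. *)
Lemma cumul_continuous : continuous M.
Proof.
move=> t; apply/cvgrPdist_lt => eps eps0.
have [N HN] := cf_gap_cvg0 irho rho01 eps0.
have N2 : (N <= N.*2)%N by rewrite -addnn leq_addr.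
have [s sE] := cumul_shift N.*2 t; have [r rE] := cumul_shift N.*2.+1 t.
have e0 := cf_gap_gt0 irho rho01 N.*2; have e1 := cf_gap_gt0 irho rho01 N.*2.+1.
have le0 := HN _ N2; have le1 := HN _ (leqW N2).
rewrite /cf_sgap -muln2 mulnC exprM sqrrN !expr1n mul1r mulnC muln2 in sE.
rewrite /cf_sgap exprS -muln2 mulnC exprM sqrrN !expr1n mulr1 mulnC muln2 in rE.
have ts : t < s by rewrite -cumul_mono_lt sE; lra.
have rt : r < t by rewrite -cumul_mono_lt rE; lra.
near=> u.
have us : u < s by near: u; exact: lt_nbhsl.
have ru : r < u by near: u; exact: lt_nbhsr.
move: us ru; rewrite -(cumul_mono_lt u s) -(cumul_mono_lt r u) ltr_norml => us ru.
apply/andP; split; lra.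
Unshelve. all: by end_near. Qed.

Lemma cumul_surj (s : R) : exists t, M t = s.
Proof.
pose n : int := Num.floor (s - M 0).
have /andP[h1 h2] := floor_itv (s - M 0); rewrite -/n in h1 h2.
have nn : n%:~R <= (n + 1)%:~R :> R by rewrite ler_int lerDl.
have [||t _ <-] := @IVT _ M n%:~R (n + 1)%:~R s nn; last by exists t.
- by apply: continuous_subspaceT; exact: cumul_continuous.
- have Mint (k : int) : M k%:~R = M 0 + k%:~R by rewrite -{1}[k%:~R]add0r cumulDint.
  rewrite !Mint; rewrite min_l ?max_r ?lerD2l //; apply/andP; split; lra.
Qed.

End circle_dynamics.

(** * The trail of a point *)

Lemma subz_ltl (i j m : nat) : (j < m)%N -> j%:Z - i%:Z < m%:Z.
Proof. lia. Qed.

Lemma subz_gtr (i j m : nat) : (i < m)%N -> - m%:Z < j%:Z - i%:Z.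
Proof. lia. Qed.

Lemma subz_eq0 (i j : nat) : i%:Z - j%:Z = 0 -> i = j.
Proof. lia. Qed.

Section trail.
Variables (R : realType) (f g : circle R -> circle R) (rho : R).
Variables (mu : probability (circle R) R) (phase : circle R -> R) (x : circle R).
Hypotheses (irho : irrational rho) (rho01 : 0 < rho < 1).
Hypothesis gK : cancel g f.
(** These hypotheses say that [phase] modulo 1 conjugates [f] to the rotation by rho, with arcs and
    their masses read off from phase differences. They are established below for the phase defined
    by [cumul]. *)
Hypothesis phase_f : forall z, phase (f z) - phase z - rho \is a Num.int.
Hypothesis phase_inj : forall a b, phase a - phase b \is a Num.int -> a = b.
Hypothesis arc_phase : forall a b z,
  Defs.arc a b z <-> 0 < fpart (phase z - phase a) <= fpart (phase b - phase a).
Hypothesis mass_phase : forall a b, fine (mu (Defs.arc a b)) = fpart (phase b - phase a).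

Local Notation q := (cf_den rho).
Local Notation e := (cf_gap rho).
Local Notation d := (cf_sgap rho).
Local Notation pos z := (phase z - phase x).
Local Notation xq n := (iter (q n) f x).

Lemma int_norm_lt1 (t : R) : t \is a Num.int -> `|t| < 1 -> t = 0.
Proof.
move=> /intrP[k ->]; rewrite -intr_norm -[1]/(1%:~R) ltr_int => k1.
by have -> : k = 0 by lia.
Qed.

Lemma phase_iter n z : phase (iter n f z) - phase z - n%:R * rho \is a Num.int.
Proof.
elim: n => [|n IH]; first by rewrite /= subrr mul0r subr0 rpred0.
have -> : phase (iter n.+1 f z) - phase z - n.+1%:R * rho =
   (phase (f (iter n f z)) - phase (iter n f z) - rho) +
   (phase (iter n f z) - phase z - n%:R * rho) by rewrite iterS -natr1; ring.
exact: rpredD.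
Qed.

Lemma phase_xq n : pos (xq n) - d n \is a Num.int.
Proof.
have -> : pos (xq n) - d n = (pos (xq n) - (q n)%:R * rho) - (d n - (q n)%:R * rho) by ring.
by apply: rpredB; [exact: phase_iter|exact: cf_sgap_int].
Qed.

Lemma cf_sgapE n : d n = if odd n then - e n else e n.
Proof. by rewrite /cf_sgap -signr_odd; case: odd; rewrite ?expr1 ?expr0 ?mulN1r ?mul1r. Qed.

Lemma fpart_xq n : fpart (pos (xq n)) = if odd n then 1 - e n else e n.
Proof.
have e0 := cf_gap_gt0 irho rho01 n; have e1 := cf_gap_lt1 irho rho01 n.
rewrite (fpart_eq (phase_xq n)) cf_sgapE; case: odd.
  rewrite -(@fpartD_int _ (- e n) 1) ?rpred1 // addrC fpart_id //; apply/andP; split; lra.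
by rewrite fpart_id // e1 ltW.
Qed.

(** The sign of d_n is (-1)^n, so I_n extends counterclockwise from [x] for even n and clockwise for
    odd n. *)
Lemma on_rightE n : on_right f rho x n = ~~ odd n.
Proof.
have e0 := cf_gap_gt0 irho rho01 n.+2.
have e1 := cf_gap_ltS irho rho01 n; have e2 := cf_gap_ltS irho rho01 n.+1.
have e3 := cf_gap_lt1 irho rho01 n.+2.
rewrite /on_right; apply/idP/idP.
  rewrite in_setE => /arc_phase; rewrite !fpart_xq /= negbK; case: (odd n) => //.
  lra.
move=> /negbTE on; rewrite in_setE; apply/arc_phase.
rewrite !fpart_xq /= on /=; apply/andP; split; lra.
Qed.

(** For odd n the positions are (-e_n, 0]; adding e_n before reducing modulo 1 keeps the closed end
    at [x] from wrapping around. *)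
Lemma dyn_intervalE n z :
  dyn_interval f rho x n z <->
  if odd n then 0 < fpart (pos z + e n) <= e n else 0 < fpart (pos z) <= e n.
Proof.
have e0 := cf_gap_gt0 irho rho01 n; have e1 := cf_gap_lt1 irho rho01 n.
rewrite /dyn_interval on_rightE; case: ifPn => on.
  by rewrite arc_phase fpart_xq (negbTE on).
rewrite negbK in on; rewrite on arc_phase.
have h := phase_xq n; rewrite cf_sgapE on opprK in h.
have -> : fpart (phase z - phase (xq n)) = fpart (pos z + e n).
  apply: fpart_eq.
  have -> : phase z - phase (xq n) - (pos z + e n) = - (pos (xq n) + e n) by ring.
  by rewrite rpredN.
have -> // : fpart (phase x - phase (xq n)) = e n.
rewrite -[RHS]fpart_id ?e1 ?ltW //; apply: fpart_eq.
by have -> : phase x - phase (xq n) - e n = - (pos (xq n) + e n); [ring|rewrite rpredN].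
Qed.

Lemma mass_dyn_interval n : fine (mu (dyn_interval f rho x n)) = e n.
Proof.
have e0 := cf_gap_gt0 irho rho01 n; have e1 := cf_gap_lt1 irho rho01 n.
rewrite /dyn_interval on_rightE; case: ifPn => on.
  by rewrite mass_phase fpart_xq (negbTE on).
rewrite negbK in on; rewrite mass_phase.
have h := phase_xq n; rewrite cf_sgapE on opprK in h.
rewrite -[RHS]fpart_id ?e1 ?ltW //; apply: fpart_eq.
by have -> : phase x - phase (xq n) - e n = - (pos (xq n) + e n); [ring|rewrite rpredN].
Qed.

Lemma fpart_int (t : R) : fpart t - t \is a Num.int.
Proof. by rewrite /fpart addrAC subrr add0r rpredN intr_int. Qed.

(** The signed d_n gives one coordinate for both orientations: z is at position d_n s, with s
    measured from [x]. *)
Lemma relative_positionP n z : dyn_interval f rho x n z ->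
  exists s, [/\ 0 <= s <= 1, pos z - d n * s \is a Num.int
              & relative_position f mu rho x n z = s].
Proof.
have e0 := cf_gap_gt0 irho rho01 n; have e1 := cf_gap_lt1 irho rho01 n.
move/dyn_intervalE; rewrite /relative_position mass_dyn_interval /subarc on_rightE cf_sgapE.
case: (odd n) => /= /andP[h1 h2]; rewrite mass_phase.
- set w := fpart _ in h1 h2.
  have wE : pos z + e n - w \is a Num.int by rewrite -opprB rpredN fpart_int.
  have -> : fpart (phase x - phase z) = e n - w.
    rewrite -[RHS]fpart_id; last by apply/andP; split; lra.
    apply: fpart_eq.
    by have -> : phase x - phase z - (e n - w) = - (pos z + e n - w); [ring|rewrite rpredN].
  exists ((e n - w) / e n); split=> //.
    by rewrite divr_ge0 ?ler_pdivrMr ?mul1r //; lra.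
  rewrite mulNr mulrCA divff ?gt_eqF // mulr1 opprK.
  by rewrite addrA.
- exists (fpart (pos z) / e n); split=> //.
    by rewrite divr_ge0 ?ler_pdivrMr ?mul1r //; lra.
  by rewrite mulrCA divff ?gt_eqF // mulr1 -opprB rpredN fpart_int.
Qed.

Lemma dyn_interval_mem n z s : 0 < s < 1 -> pos z - d n * s \is a Num.int ->
  dyn_interval f rho x n z.
Proof.
have e0 := cf_gap_gt0 irho rho01 n; have e1 := cf_gap_lt1 irho rho01 n.
move=> /andP[s0 s1] h; apply/dyn_intervalE.
have se0 : 0 < s * e n by rewrite mulr_gt0.
have se1 : s * e n < e n by rewrite gtr_pMl.
move: h; rewrite cf_sgapE; case: (odd n) => h.
  have -> : fpart (pos z + e n) = e n - s * e n.
    rewrite -[RHS]fpart_id; last by apply/andP; split; lra.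
    apply: fpart_eq; move: h; congr (_ \is a _); ring.
  apply/andP; split; lra.
have -> : fpart (pos z) = s * e n.
  rewrite -[RHS]fpart_id; last by apply/andP; split; lra.
  by apply: fpart_eq; rewrite [s * _]mulrC.
by rewrite se0 ltW.
Qed.

(** The point g^i y lies in the base. As [xget] may return any base point, uniqueness of its
    coordinate is needed: two representations put (i - i') rho closer than e_n to an integer, so i =
    i' by [cf_best_approx], and then s = s'. *)
Lemma tower_base_position n m y i s : (m <= q n.+1)%N -> (i < m)%N -> 0 < s < 1 ->
  pos y - (i%:R * rho + d n * s) \is a Num.int ->
  tower_base f rho x n m y !=set0 /\
  relative_position f mu rho x n (xget x (tower_base f rho x n m y)) = s.
Proof.
have e0 := cf_gap_gt0 irho rho01 n; have e1 := cf_gap_lt1 irho rho01 n.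
move=> mq im s01 h; pose z := iter i g y.
have zy : iter i f z = y.
  by rewrite /z; elim: i {im h z} => // i IH; rewrite iterSr [iter i.+1 g y]iterS gK.
have tz : tower_base f rho x n m y z.
  split; last by exists i.
  apply: (dyn_interval_mem s01).
  have -> : pos z - d n * s = (pos y - (i%:R * rho + d n * s)) -
     (phase (iter i f z) - phase z - i%:R * rho) by rewrite zy; ring.
  by rewrite rpredB // phase_iter.
split; first by exists z.
have := xgetPex x (ex_intro _ z tz); set z' := xget _ _ => -[dz' [i' i'm z'y]].
have [s' [s'01 z'E ->]] := relative_positionP dz'.
have hd : (i%:R * rho + d n * s) - (i'%:R * rho + d n * s') \is a Num.int.
  have -> : (i%:R * rho + d n * s) - (i'%:R * rho + d n * s') =
    (pos z' - d n * s') + (phase (iter i' f z') - phase z' - i'%:R * rho)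
     - (pos y - (i%:R * rho + d n * s)) by rewrite z'y; ring.
  by rewrite rpredB // rpredD // phase_iter.
have ss : `|s' - s| < 1 by rewrite ltr_norml; apply/andP; split; lra.
have dss : `|d n * (s' - s)| < e n.
  by rewrite /cf_sgap -mulrA !normrM normrX normrN1 expr1n mul1r (gtr0_norm e0) gtr_pMr.
have /intrP[p pE] := hd.
have ii' : i%:Z - i'%:Z = 0.
  apply: (cf_best_approx irho rho01 (n := n) (p := p)).
    rewrite ltr_norml subz_ltl ?subz_gtr //; exact: leq_trans mq.
  by rewrite -pE intrB -!pmulrn; move: dss; congr (`|_| < _); ring.
move: hd; rewrite -(subz_eq0 ii').
have -> : i%:R * rho + d n * s - (i%:R * rho + d n * s') = - (d n * (s' - s)) by ring.
rewrite rpredN => /int_norm_lt1; rewrite (lt_trans dss) // => /(_ isT)/eqP.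
rewrite /cf_sgap -mulrA mulf_eq0 signr_eq0 /= mulf_eq0 gt_eqF //= subr_eq0.
by move/eqP.
Qed.

Lemma trail_alpha_long n y i s : (i < q n.+1)%N -> 0 < s < 1 ->
  pos y - (i%:R * rho + d n * s) \is a Num.int ->
  trail_alpha f mu rho x y n.+1 = s.
Proof.
move=> iq s01 h; have [ne rs] := tower_base_position (leqnn _) iq s01 h.
by rewrite /trail_alpha; case: asboolP.
Qed.

(** Since [trail_alpha] tests the long tower first, that tower must be shown empty: a point of it
    over y would give (j - i) rho = (-1)^n (e_n s' + e_(n+1) s) modulo 1, against [cf_tower_gap]. *)
Lemma trail_alpha_short n y j s : (j < q n)%N -> 0 < s < 1 ->
  pos y - (j%:R * rho + d n.+1 * s) \is a Num.int ->
  trail_alpha f mu rho x y n.+1 = - s.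
Proof.
move=> jq s01 h.
have qq : (q n <= q n.+2)%N by rewrite (leq_trans (cf_den_leS _ _ _)) // cf_den_leS.
have [ne rs] := tower_base_position qq jq s01 h.
rewrite /trail_alpha; case: asboolP => [[z [dz [i iq zy]]]|_]; last by rewrite rs.
have [s' [/andP[s'0 s'1] zE _]] := relative_positionP dz.
have e0 := cf_gap_gt0 irho rho01 n; have e1 := cf_gap_gt0 irho rho01 n.+1.
have hd : (j%:R - i%:R) * rho - (d n * s' - d n.+1 * s) \is a Num.int.
  have -> : (j%:R - i%:R) * rho - (d n * s' - d n.+1 * s) =
    (pos z - d n * s') + (phase (iter i f z) - phase z - i%:R * rho)
     - (pos y - (j%:R * rho + d n.+1 * s)) by rewrite zy; ring.
  by rewrite rpredB // rpredD // phase_iter.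
have /intrP[p pE] := hd.
have := @cf_tower_gap _ _ irho rho01 n (j%:Z - i%:Z) p.
move=> /(_ (subz_gtr _ iq) (subz_ltl _ jq))/negP ntower; exfalso; apply: ntower.
rewrite intrB -!pmulrn -pE.
have -> : (j%:R - i%:R) * rho - ((j%:R - i%:R) * rho - (d n * s' - d n.+1 * s)) =
  (-1) ^+ n * (e n * s' + e n.+1 * s) by rewrite /cf_sgap exprS; ring.
rewrite mulrA -exprMn mulrNN mul1r expr1n mul1r.
case/andP: s01 => s0 s1.
have h1 : 0 <= e n * s' <= e n by rewrite mulr_ge0 ?(ltW e0) //= ger_pMr.
have h2 : 0 < e n.+1 * s < e n.+1 by rewrite mulr_gt0 //= gtr_pMr.
apply/andP; split; lra.
Qed.

End trail.

(** * Almost every position meets a given target of the trail *)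

Section trail_targets.
Variables (R : realType) (rho : R).
Hypotheses (irho : irrational rho) (rho01 : 0 < rho < 1).
Local Notation lambda := (@lebesgue_measure R).
Local Notation q := (cf_den rho).
Local Notation e := (cf_gap rho).
Local Notation d := (cf_sgap rho).
Local Notation tail := (cf_tail rho).

(* Positions, relative to [x], of the points [y] for which some pair
   [(rho_(n+1), alpha_(n+1))] of the trail lies in [(u0, u1) * (v0, v1)] (long
   intervals, [b = true]) or [(u0, u1) * (- v1, - v0)] (short ones). *)
Definition trail_target (u0 u1 v0 v1 : R) (b : bool) : set R :=
  [set t | exists n, u0 < tail n.+1 < u1 /\
     exists i s, [/\ (i < (if b then q n.+1 else q n))%N, v0 < s < v1 &
       t - (i%:R * rho + d (if b then n else n.+1) * s) \is a Num.int]].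

Lemma normr_cf_sgap n : `|d n| = e n.
Proof.
by rewrite /cf_sgap normrM normrX normrN1 expr1n mul1r gtr0_norm // cf_gap_gt0.
Qed.

(** Porosity at scale e_(n+1): a point j rho lies within 4 e_(n+1) of t - m, and the target interval
    beside it has length at least u0 (v1 - v0) e_(n+1). *)
Lemma negligible_trail_target (u0 u1 v0 v1 m : R) b :
  0 < u0 -> v0 < v1 -> 0 <= v0 -> v1 <= 1 ->
  (forall N, exists2 n, (N <= n)%N & 2^-1 < tail n /\ u0 < tail n.+1 < u1) ->
  lambda.-negligible
    (~` ([set t | trail_target u0 u1 v0 v1 b (t - m)] : set R)^°).
Proof.
move=> u00 v01 v00 v11 vis; set V := [set t | _].
suff : lambda.-negligible ([set: R] `\` (V : set R)^°) by rewrite setTD.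
apply: (@negligible_porous _ _ _ (u0 * (v1 - v0) / 6)); first exact: open_interior.
  by rewrite divr_gt0 // mulr_gt0 // subr_gt0.
move=> t _ eps eps0.
have [|N HN] := cf_gap_cvg0 irho rho01 (eps := eps / 6); first by rewrite divr_gt0.
have [[|n] Nn [tn ut]] := vis N.+1; first by [].
have [j jq [k jk]] := cf_covering_gap irho rho01 (t - m) tn.
have en := HN n.+1 (leq_trans (leqnSn _) Nn).
have e0 := cf_gap_gt0 irho rho01 n.+1.
(* Signed length of the dynamical interval carrying the target; the lower bound on the tail makes
   short and long ones comparable. *)
set D := d (if b then n.+1 else n.+2).
have D1 : `|D| <= e n.+1.
  by rewrite /D; case: (b); rewrite normr_cf_sgap // ltW // cf_gap_ltS.
have D0 : u0 * e n.+1 <= `|D|.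
  case/andP: ut => ut _; rewrite /D; case: (b); rewrite normr_cf_sgap.
    rewrite ger_pMl // (le_trans (ltW ut)) //.
    by have /andP[_ /ltW] := cf_tail_itv irho rho01 n.+2.
  by rewrite [e n.+2]cf_gapS ler_pM2r // ltW.
have Dn0 : D != 0 by rewrite -normr_gt0 (lt_le_trans _ D0) // mulr_gt0.
pose c0 := m + j%:R * rho + k%:~R.
pose a0 := c0 + D * v0; pose a1 := c0 + D * v1.
have inV y : Num.min a0 a1 < y < Num.max a0 a1 ->
    exists2 s, v0 < s < v1 & y = c0 + D * s.
  move=> y01; exists ((y - c0) / D); last by rewrite mulrCA divff // mulr1 addrC subrK.
  move: y01 Dn0; rewrite /a0 /a1 neq_lt => /andP[y0 y1] /orP[Dlt|Dgt].
    rewrite min_r ?max_l in y0 y1; [|nra..].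
    by rewrite ltr_ndivrMr // ltr_ndivlMr // !(mulrC _ D); apply/andP; split; lra.
  rewrite min_l ?max_r in y0 y1; [|nra..].
  by rewrite ltr_pdivrMr // ltr_pdivlMr // !(mulrC _ D); apply/andP; split; lra.
(* The target is at distance at most 4 e_(n+1) + |D| <= 5 e_(n+1) from t, so radius 6 e_(n+1) leaves
   room for strict inequality. *)
exists (6 * e n.+1), (Num.min a0 a1), (Num.max a0 a1); split.
- by rewrite mulr_gt0 //=; lra.
- have -> : Num.max a0 a1 - Num.min a0 a1 = `|D| * (v1 - v0).
    have aE : a1 - a0 = D * (v1 - v0) by rewrite /a0 /a1; ring.
    rewrite -[v1 - v0]gtr0_norm ?subr_gt0 // -normrM -aE.
    by case: (lerP a0 a1) => h; lra.
  have -> : u0 * (v1 - v0) / 6 * (6 * e n.+1) = (u0 * e n.+1) * (v1 - v0) by field.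
  by rewrite ler_pM2r // subr_gt0.
- move=> y; rewrite /= in_itv /= => /inV[s /andP[s0 s1] ->]; rewrite /ball /=.
  have -> : t - (c0 + D * s) = (t - m - j%:R * rho - k%:~R) - D * s by rewrite /c0; ring.
  have := ler_normB (t - m - j%:R * rho - k%:~R) (D * s).
  have : `|D * s| <= `|D|.
    by rewrite normrM ler_piMr // ger0_norm; lra.
  lra.
- apply: itvoo_subset_interior => y; rewrite /= in_itv /= => /inV[s s01 ->].
  exists n.+1; split=> //; exists j, s; split=> //.
    by case: (b) => //; rewrite (leq_trans jq) // cf_den_leS.
  have -> : c0 + D * s - m - (j%:R * rho + D * s) = k%:~R by rewrite /c0; ring.
  exact: intr_int.
Qed.

Lemma trail_targetD_int u0 u1 v0 v1 b t k : k \is a Num.int ->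
  trail_target u0 u1 v0 v1 b t -> trail_target u0 u1 v0 v1 b (t + k).
Proof.
move=> ik [n [un [i [s [iq vs h]]]]]; exists n; split=> //; exists i, s; split=> //.
by rewrite addrAC rpredD.
Qed.

End trail_targets.

(** A single window suffices: a tail between 1 / (1 + u1) and 1 / (1 + u0) exceeds 1/2, so its first
    digit is 1 and the next tail, its inverse minus 1, lies between u0 and u1. *)
Lemma gauss_generic_visits (R : realType) (rho : R) (u0 u1 : rat) N :
  gauss_generic rho -> 0 < u0 -> u0 < u1 -> u1 <= 1 ->
  exists2 n, (N <= n)%N &
    2^-1 < cf_tail rho n /\ ratr u0 < cf_tail rho n.+1 < ratr u1.
Proof.
move=> [rho01 irho vis] u00 u01 u11.
have [||| n Nn /andP[]] := vis (1 + u1)^-1 (1 + u0)^-1 N.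
- by rewrite invr_ge0; lra.
- by rewrite ltf_pV2 ?posrE; lra.
- by rewrite invf_le1; lra.
have q0 : 0 < ratr u0 :> R by rewrite ltr0q.
have p0 : 0 < 1 + ratr u0 :> R by lra.
have p1 : 0 < 1 + ratr u1 :> R by rewrite addr_gt0 // ltr0q; lra.
have u11' : ratr u1 <= 1 :> R by rewrite -(rmorph1 ratr) ler_rat.
rewrite !fmorphV !rmorphD !rmorph1 => h0 h1; exists n => //.
have t0 : 0 < cf_tail rho n by rewrite (lt_trans _ h0) // invr_gt0.
have th : 2^-1 < cf_tail rho n.
  by apply: le_lt_trans h0; rewrite lef_pV2 ?posrE //; lra.
have t1 : 1 < (cf_tail rho n)^-1.
  by rewrite invf_gt1 //; apply: (lt_le_trans h1); rewrite invf_le1 //; lra.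
split=> //.
have gE : cf_tail rho n.+1 = (cf_tail rho n)^-1 - 1.
  rewrite [LHS]/= /gauss -/(cf_tail rho n).
  have -> // : Num.floor (cf_tail rho n)^-1 = 1.
  apply: floor_def; rewrite (ltW t1) /= invf_plt ?posrE ?ltr0n //.
rewrite gE ltrBrDl ltrBlDl; apply/andP; split.
  by rewrite -[ltLHS]invrK ltf_pV2 ?posrE ?invr_gt0.
by rewrite -[ltRHS]invrK ltf_pV2 ?posrE ?invr_gt0.
Qed.

(** The window is cut off at 0 and 1 and need not contain s; only its points being close to s
    matters, so the end values of s are allowed. *)
Lemma rat_window (R : realType) (s eps : R) : 0 <= s <= 1 -> 0 < eps ->
  exists u0 u1 : rat, [/\ 0 < u0, u0 < u1, u1 <= 1 &
    forall r, ratr u0 < r < ratr u1 -> `|s - r| < eps].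
Proof.
move=> /andP[s0 s1] eps0; pose l := Num.max 0 (s - eps); pose h := Num.min 1 (s + eps).
have lh : l < h by rewrite /l /h lt_min !gt_max; apply/andP; split; apply/andP; split; lra.
have [u0] := rat_in_itvoo lh; rewrite in_itv /= => /andP[lu0 u0h].
have [u1] := rat_in_itvoo u0h; rewrite in_itv /= => /andP[u01 u1h].
move: lu0 u1h; rewrite gt_max lt_min => /andP[u00 su0] /andP[u11 su1].
exists u0, u1; split.
- by rewrite ltr0q in u00.
- by rewrite ltr_rat in u01.
- by rewrite -(ler_rat R) rmorph1 ltW.
- by move=> r /andP[r0 r1]; rewrite ltr_norml; apply/andP; split; lra.
Qed.

(** * The phase on the circle and transfer of null sets *)

Section circle_phase.
Variables (R : realType) (mu : probability (circle R) R).
Local Notation S := (@to_circle R).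
Local Notation M := (cumul mu).
Local Notation lambda := (@lebesgue_measure R).
Hypothesis M_lt : {homo M : a b / a < b}.

Definition phase (z : circle R) : R := M (repr z).

Lemma phase_to_circle t : phase (S t) - M t \is a Num.int.
Proof.
have /to_circle_eqP/intrP[k kE] := to_circleK (S t).
have -> : phase (S t) = M t + k%:~R.
  by rewrite -cumulDint -kE addrC subrK.
by rewrite addrAC subrr add0r intr_int.
Qed.

Lemma phase_inj a b : phase a - phase b \is a Num.int -> a = b.
Proof.
move=> /intrP[k kE]; have M_le := le_mono M_lt.
have : M (repr a) = M (repr b + k%:~R).
  by rewrite cumulDint -kE addrC subrK.
move=> /(inc_inj M_le) ab.
by rewrite -(to_circleK a) -(to_circleK b) ab to_circleDint.
Qed.

(** Along a counterclockwise path shorter than a turn, [M] increases by less than 1, so the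
    fractional part is the actual increment. *)
Lemma fpart_phaseB a z :
  fpart (phase z - phase a) = M (repr a + ccw a z) - M (repr a).
Proof.
have /andP[c0 c1] := ccw_itv a z; have M_le := le_mono M_lt.
have zE : S (repr a + ccw a z) = z.
  by rewrite -{2}(to_circleK a) to_circle_ccw.
have h : phase z - M (repr a + ccw a z) \is a Num.int.
  by rewrite -{1}zE; exact: phase_to_circle.
rewrite -[RHS]fpart_id; last first.
  have : M (repr a) <= M (repr a + ccw a z) by rewrite M_le lerDl.
  have : M (repr a + ccw a z) < M (repr a + 1%:~R) by apply: M_lt; rewrite ltrD2l.
  by rewrite cumulDint => *; apply/andP; split; lra.
apply: fpart_eq; move: h; congr (_ \is a _); rewrite /phase; ring.
Qed.

Lemma arc_phase a b z :
  Defs.arc a b z <-> 0 < fpart (phase z - phase a) <= fpart (phase b - phase a).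
Proof.
have M_le := le_mono M_lt; have M_ltm := leW_mono M_le.
by rewrite !fpart_phaseB subr_gt0 lerD2r M_ltm M_le ltrDl lerD2l.
Qed.

Lemma mass_phase a b : fine (mu (Defs.arc a b)) = fpart (phase b - phase a).
Proof.
have /andP[c0 c1] := ccw_itv a b.
rewrite fpart_phaseB cumulB ?lerDl //; last by rewrite lerD2l ltW.
by rewrite -{1}(to_circleK a) arc_ccw to_circleK.
Qed.

Hypothesis M_surj : forall s, exists t, M t = s.

Lemma cumul_preimage a b : exists c d, [/\ M c = a, M d = b &
  M @^-1` `]a, b] = `]c, d]%classic].
Proof.
have M_le := le_mono M_lt; have M_ltm := leW_mono M_le.
have [c cE] := M_surj a; have [d dE] := M_surj b; exists c, d; split=> //.
by apply/seteqP; split=> t; rewrite /= !in_itv /= -cE -dE M_ltm M_le.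
Qed.

Lemma mass_le_length a b : a <= b ->
  (mu (S @` (M @^-1` `]a, b])) <= (b - a)%:E)%E.
Proof.
move=> ab; have [c [d [cE dE ->]]] := cumul_preimage a b.
have M_le := le_mono M_lt.
rewrite arc_massE lee_fin -cE -dE.
have cd : c <= d by rewrite -M_le cE dE.
(* Beyond one turn the mass is still at most 1, while [M] has grown by at least 1. *)
have [dc|dc] := leP d (c + 1); first by rewrite cumulB.
have := arc_mass_le1 mu c d; have : M (c + 1%:~R) <= M d by rewrite M_le ltW.
rewrite cumulDint; lra.
Qed.

(* [cumul] transports [mu] to Lebesgue measure; only null sets matter here. *)
Lemma null_transfer (E : set R) (Z : set (circle R)) : lambda.-negligible E ->
  measurable Z -> (forall z, Z z -> exists2 t, S t = z & E (M t)) -> mu Z = 0.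
Proof.
move=> [A [mA A0 EA]] mZ ZE; apply/eqP; rewrite eq_le measure_ge0 andbT -A0.
(* Lebesgue measure is an infimum over countable covers by half-open intervals; each cover of [A]
   pulls back to a cover of [Z] by arcs of no larger mass. *)
apply: le_ereal_inf_tmp => _ [C [mC AC] <-].
pose D k := S @` (M @^-1` (C k)).
have Ck k : measurable (D k) /\ (mu (D k) <= wlength idfun (C k))%E.
  have /ocitvP[C0|[[a b] /= /ltW ab CE]] := mC k; rewrite /D.
    by rewrite C0 preimage_set0 image_set0 measure0 wlength0.
  rewrite CE wlength_itv_bnd //; split; last exact: mass_le_length.
  by have [c [d [_ _ ->]]] := cumul_preimage a b; exact: measurable_arc.
apply: (@le_trans _ _ (\sum_(0 <= k <oo) mu (D k))%E).
  apply: measure_sigma_subadditive => //; first by move=> k; have [] := Ck k.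
  move=> z /ZE[t tz /EA/AC[k _ Ckt]]; exists k => //; by exists t.
by apply: lee_nneseries => // k _; have [] := Ck k.
Qed.

End circle_phase.

(** * Open sets of full measure whose points reach a given target *)

Section generic_points.
Variables (R : realType) (f : circle R -> circle R) (rho : R).
Variables (mu : probability (circle R) R) (x : circle R).
Hypotheses (homeo_f : orientation_preserving_homeo f) (min_f : minimal f).
Hypotheses (rot_f : is_rotation_number f rho) (inv_f : invariant_measure f mu).
Hypothesis gen_rho : gauss_generic rho.
Local Notation S := (@to_circle R).
Local Notation M := (cumul mu).
Local Notation phase := (phase mu).

Lemma gauss_generic_itv : irrational rho /\ 0 < rho < 1.
Proof.
have [/andP[r0 r1] ir _] := gen_rho; split=> //.
have : forall k : int, rho != k%:~R.
  by move=> k; apply/eqP => rE; apply: ir; exists k%:~R => //; rewrite ratr_int.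
by move=> rk; rewrite !lt_neqAle r0 r1 (rk 1) eq_sym (rk 0).
Qed.

Lemma cumul_facts : [/\ {homo M : a b / a < b}, continuous M,
  forall s, exists t, M t = s & forall z, phase (f z) - phase z - rho \is a Num.int].
Proof.
have [ir r01] := gauss_generic_itv.
have [[g [fK gK cf cg]] _] := homeo_f; have [_ [F liftF rotF]] := rot_f.
split.
- exact: cumul_lt fK cf cg min_f inv_f.
- exact: cumul_continuous fK cf cg min_f liftF rotF inv_f ir r01.
- exact: cumul_surj fK cf cg min_f liftF rotF inv_f ir r01.
- move=> z; have := phase_to_circle mu (F (repr z)).
  rewrite (to_circle_lift liftF) to_circleK (cumul_lift liftF rotF inv_f).
  by rewrite opprD addrA.
Qed.

(** The interior is taken so that the set is open, as residuality demands, and hence Borel. *)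
Definition good_points (u0 u1 v0 v1 : R) (b : bool) : set (circle R) :=
  ([set y | trail_target rho u0 u1 v0 v1 b (phase y - phase x)] : set (circle R))^°.

Lemma good_points_trail u0 u1 v0 v1 b y : 0 <= v0 -> v1 <= 1 ->
  good_points u0 u1 v0 v1 b y ->
  exists n s, [/\ u0 < cf_tail rho n < u1, v0 < s < v1 &
    trail_alpha f mu rho x y n = if b then s else - s].
Proof.
have [ir r01] := gauss_generic_itv; have [M_lt _ _ ph_f] := cumul_facts.
have [[g [_ gK _ _]] _] := homeo_f.
move=> v00 v11 /interior_subset /= [n [un [i [s [iq vs h]]]]].
have s01 : 0 < s < 1 by case/andP: vs => *; apply/andP; split; lra.
have ai := arc_phase M_lt; have mi := mass_phase M_lt.
exists n.+1, s; split=> //; case: b iq h => iq h.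
  exact: (trail_alpha_long ir r01 gK ph_f ai mi iq s01 h).
exact: (trail_alpha_short ir r01 gK ph_f ai mi iq s01 h).
Qed.

Lemma open_good_points u0 u1 v0 v1 b : open (good_points u0 u1 v0 v1 b).
Proof. exact: open_interior. Qed.

Lemma null_good_pointsC (u0 u1 : rat) (v0 v1 : R) b :
  0 < u0 -> u0 < u1 -> u1 <= 1 -> v0 < v1 -> 0 <= v0 -> v1 <= 1 ->
  mu (~` good_points (ratr u0) (ratr u1) v0 v1 b) = 0.
Proof.
move=> u00 u01 u11 v01 v00 v11.
have [ir r01] := gauss_generic_itv; have [M_lt M_c M_s _] := cumul_facts.
have u0R : 0 < ratr u0 :> R by rewrite ltr0q.
have := @negligible_trail_target _ _ ir r01 _ _ _ _ (phase x) b u0R v01 v00 v11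
  (fun N => gauss_generic_visits N gen_rho u00 u01 u11).
set V := [set t | _] => nV.
apply: (null_transfer M_lt M_s nV).
  by apply: measurableC; apply: open_measurable_circle; exact: open_good_points.
move=> z zG; exists (repr z); first exact: to_circleK.
move=> Vz; apply: zG.
(* [M] is continuous and [S] is open, so the interior found on the line becomes an open set of the
   circle, contained in the interior defining [good_points]. *)
have oV : open (S @` (M @^-1` (V : set R)^°)).
  by apply: open_image_to_circle; move/continuousP: M_c; apply; exact: open_interior.
rewrite /good_points; move: z Vz; rewrite /phase.
suff : S @` (M @^-1` (V : set R)^°) `<=` (good_points (ratr u0) (ratr u1) v0 v1 b).
  by move=> sub z Vz; apply: sub; exists (repr z) => //; exact: to_circleK.
rewrite /good_points -open_subsetE // => _ [t /interior_subset Vt <-] /=.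
have -> : phase (S t) - phase x = (M t - phase x) + (phase (S t) - M t) by ring.
exact: trail_targetD_int (phase_to_circle mu t) Vt.
Qed.

(** An open set disjoint from [U] would contain an arc, which has positive mass by minimality. *)
Lemma dense_of_null (U : set (circle R)) : open U -> mu (~` U) = 0 -> dense U.
Proof.
have [[g [fK gK cf cg]] _] := homeo_f.
move=> oU U0 W [z Wz] oW; apply: contrapT => /forallNP WU.
have : nbhs (repr z) (S @^-1` W).
  by apply: open_nbhs_nbhs; split; [exact: oW|rewrite /= to_circleK].
move=> /nbhs_ballP[r /= r0 rW].
pose a := repr z - r / 2; pose b := repr z + r / 2.
have ab : a < b by rewrite /a /b; lra.
have /eqP : (arc_mass mu a b)%:E = 0%E.
  apply/eqP; rewrite -arc_massE eq_le measure_ge0 andbT -U0.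
  apply: le_measure; rewrite ?inE.
  - exact: measurable_arc.
  - by apply: measurableC; exact: open_measurable_circle.
  - move=> _ [t + <-] Ut; rewrite /= in_itv /= => /andP[at_ tb].
    apply: (WU (S t)); split=> //; apply: rW.
    by rewrite /ball /= ltr_norml; apply/andP; split; rewrite /a /b in at_ tb; lra.
by rewrite eqe gt_eqF // (arc_mass_gt0 fK cf cg min_f inv_f ab).
Qed.

End generic_points.

(** * Intersection of the good sets over all rational windows *)

Theorem theorem2p5 (R : realType) :
  exists RR : set R,
    [/\ RR `<=` `[0, 1] `&` @irrational R,
        (@lebesgue_measure R).-negligible (`[0, 1] `\` RR)
      & forall (f : circle R -> circle R) (rho : R)
               (mu : probability (circle R) R) (x : circle R),
          orientation_preserving_homeo f ->
          minimal f ->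
          is_rotation_number f rho ->
          RR rho ->
          invariant_measure f mu ->
          exists B : set (circle R),
            [/\ residual B,
                mu.-negligible (~` B)
              & forall y, B y ->
                  `[0, 1] `*` `[-1, 1] `<=`
                    closure (range (renormalization_trail f mu rho x y))]].
Proof.
exists (@gauss_generic R); split.
- by move=> r [r01 ir _]; split=> //=; rewrite in_itv.
- exact: negligible_gauss_nongeneric.
move=> f rho mu x homeo_f min_f rot_f gen_rho inv_f.
(* A countable family: a window for the tail, a window for |alpha|, and a boolean for the sign of
   alpha. Invalid windows get the whole circle. *)
pose valid (i : rat * rat * (rat * rat) * bool) :=
  let: (u0, u1, (v0, v1), _) := i in
  [&& 0 < u0, u0 < u1, u1 <= 1, 0 < v0, v0 < v1 & v1 <= 1].
pose G (i : rat * rat * (rat * rat) * bool) : set (circle R) :=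
  if valid i then let: (u0, u1, (v0, v1), b) := i in
    good_points rho mu x (ratr u0) (ratr u1) (ratr v0) (ratr v1) b
  else setT.
have oG i : open (G i).
  case: i => -[[u0 u1] [v0 v1]] b; rewrite /G; case: ifP => _; last exact: openT.
  exact: open_good_points.
have nG i : mu (~` G i) = 0.
  case: i => -[[u0 u1] [v0 v1]] b; rewrite /G.
  case: ifP => [/and5P[u00 u01 u11 v00 /andP[v01 v11]]|_]; last first.
    by rewrite setCT measure0.
  apply: (null_good_pointsC x homeo_f min_f rot_f inv_f gen_rho) => //.
  - by rewrite ltr_rat.
  - by rewrite ler0q ltW.
  - by rewrite -(rmorph1 ratr) ler_rat.
(* Enumeration by natural numbers, as residuality and countable unions require; numbers coding no
   index get [setT]. *)
pose H (k : nat) := oapp G setT (unpickle k).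
have oH k : open (H k) by rewrite /H; case: unpickle => [i|]; [exact: oG|exact: openT].
have nH k : mu (~` H k) = 0.
  by rewrite /H; case: unpickle => [i|]; [exact: nG|rewrite setCT measure0].
exists (\bigcap_k H k); split.
- exists (\bigcap_k H k) => //; exists H => // k; split=> //.
  exact: (dense_of_null homeo_f min_f inv_f).
- rewrite setC_bigcap; apply: negligible_bigcup => k; apply/negligibleP; last exact: nH.
  by apply: measurableC; exact: open_measurable_circle.
move=> y By [s t] [/= s01 t11] W /nbhs_ballP[eps /= eps0 epsW].
rewrite !in_itv /= in s01 t11.
have [u0 [u1 [u00 u01 u11 us]]] := rat_window s01 eps0.
have tn : 0 <= `|t| <= 1 by rewrite normr_ge0 ler_norml.
have [v0 [v1 [v00 v01 v11 vt]]] := rat_window tn eps0.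
(* The sign of t selects long or short intervals, so approximating |t| by a relative position is
   enough. *)
pose b := 0 <= t.
have : G (u0, u1, (v0, v1), b) y.
  by have := By (pickle (u0, u1, (v0, v1), b)) I; rewrite /H pickleK.
rewrite /G /= u00 u01 u11 v00 v01 v11 /= => yG.
have [||n [r [un vr al]]] := good_points_trail homeo_f min_f rot_f inv_f gen_rho _ _ yG.
- by rewrite ler0q ltW.
- by rewrite -(rmorph1 ratr) ler_rat.
exists (renormalization_trail f mu rho x y n); split; first by exists n.
apply: epsW; split; rewrite /ball /=; first exact: us.
have tr := vt r vr; rewrite al /b; case: (leP 0 t) tr => t0.
  by rewrite (ger0_norm t0).
by rewrite (ltr0_norm t0) opprK -opprD normrN.
Qed.
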